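(* Let $K$ be a $p$-adic field, and let $F/K$ be a finite normal tamely ramified split extension with $\zeta_p\in F$ and $H=\mathrm{Gal}(F/K)$. Let $I_F=\frac{pe_F}{p-1}$, and let $\llbracket 0,I_F\rrbracket$ be the set of integers prime to $p$ in the interval $[0,I_F]$. Denote by $\mathbb{F}_p$ and $M_\omega$ the $\mathbb{F}_p[H]$-module $\mathbb{F}_p$ with, respectively, the trivial action and the action given by the cyclotomic character $\omega$. Then there is an isomorphism of $\mathbb{F}_p[H]$-modules $$F^\times/(F^\times)^p\cong\mathbb{F}_p\oplus\Bigl(\bigoplus_{i\in\llbracket 0,I_F\rrbracket}M_i\Bigr)\oplus M_\omega,$$ where the modules $M_i$ are defined in the context.
   Context: $e_F$ is the absolute ramification index of $F$; $\kappa_F$ and $\kappa_K$ are the residue fields and $q=|\kappa_K|$. ''Split'' means that $H=T\rtimes U$ where $T=\langle\tau\rangle$ is the inertia subgroup (cyclic of order $e=e(F/K)$, coprime to $p$) and $U=\langle\upsilon\rangle$ is a complement generated by a lifting $\upsilon$ of the Frobenius $x\mapsto x^q$. Let $F'$ be the fixed field of $U$; choose a uniformizer $\pi$ of $F'$ (hence of $F$) which is an $e$-th root of a uniformizer of $K$, and let $\zeta=\tau(\pi)/\pi$, a primitive $e$-th root of unity, with image $\bar\zeta\in\kappa_F$. For $i\ge1$, $M_i$ is the module with underlying set $\kappa_F$ and $H$-action $\tau(\bar\alpha)=\bar\zeta^i\bar\alpha$, $\upsilon(\bar\alpha)=\bar\alpha^q$. The cyclotomic character $\omega:H\to\mathbb{F}_p^\times$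 is defined by $\sigma(\zeta_p)=\zeta_p^{\omega(\sigma)}$, where $\zeta_p$ is a primitive $p$-th root of unity. *)

(* Defs.v *)
From HB Require Import structures.
From mathcomp Require Import all_boot all_order all_algebra all_fingroup.
From mathcomp Require Import all_solvable all_field.
From mathcomp Require Import ring_quotient finmap boolp classical_sets cardinality.

Set Implicit Arguments.
Unset Strict Implicit.
Unset Printing Implicit Defensive.

Import Order.TTheory GRing.Theory Num.Theory.

Local Open Scope ring_scope.

(* MathComp composes Galois automorphisms from left to right,
   (g * h)%g x = h (g x); hence [act_mul] is the law of a left module over the
   Galois group in the usual convention. *)
Record FpH_action (p : nat) (gT : finGroupType) (H : {group gT})
    (V : lmodType 'F_p) := FpHAction {
  act :> gT -> V -> V;
  act_linear : forall g, g \in H -> linear (act g);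
  act_one : forall x, act 1%g x = x;
  act_mul : forall g h, g \in H -> h \in H ->
    forall x, act (g * h)%g x = act h (act g x)
}.

Definition FpH_iso (p : nat) (gT : finGroupType) (H : {group gT})
    (V W : lmodType 'F_p) (A : FpH_action H V) (B : FpH_action H W) : Prop :=
  exists f : {linear V -> W},
    bijective f /\ forall h, h \in H -> forall x, f (A h x) = B h (f x).

Section Actions.
Variables (p : nat) (gT : finGroupType) (H : {group gT}).

#[local] Obligation Tactic := idtac.

Program Definition FpH_trivial : FpH_action H ('F_p)^o :=
  @FpHAction p gT H _ (fun _ x => x) _ _ _.
Next Obligation. by []. Qed.
Next Obligation. by []. Qed.
Next Obligation. by []. Qed.

Program Definition FpH_sum (V W : lmodType 'F_p) (A : FpH_action H V)
    (B : FpH_action H W) : FpH_action H (V * W)%type :=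
  @FpHAction p gT H _ (fun g x => (A g x.1, B g x.2)) _ _ _.
Next Obligation.
by move=> V W A B g Hg a [x x'] [y y'] /=; rewrite !act_linear.
Qed.
Next Obligation. by move=> V W A B [x y] /=; rewrite !act_one. Qed.
Next Obligation. by move=> V W A B g h Hg Hh [x y] /=; rewrite !act_mul. Qed.

Program Definition FpH_bigsum (I : finType) (V : lmodType 'F_p)
    (A : I -> FpH_action H V) : FpH_action H {ffun I -> V} :=
  @FpHAction p gT H _ (fun g x => [ffun i => A i g (x i)]) _ _ _.
Next Obligation.
by move=> I V A g Hg a x y; apply/ffunP=> i; rewrite !ffunE act_linear.
Qed.
Next Obligation. by move=> I V A x; apply/ffunP=> i; rewrite ffunE act_one. Qed.
Next Obligation.
by move=> I V A g h Hg Hh x; apply/ffunP=> i; rewrite !ffunE act_mul.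
Qed.

End Actions.

(* An abelian group killed by p, as an F_p-vector space. *)
Definition Fp_space (p : nat) (p_pr : prime p) (V : zmodType)
  (pV : forall x : V, x *+ p = 0) : Type := V.

Section FpSpace.
Variables (p : nat) (p_pr : prime p) (V : zmodType).
Variable pV : forall x : V, x *+ p = 0.
Local Notation W := (Fp_space p_pr pV).

HB.instance Definition _ := GRing.Zmodule.on W.

Definition Fp_scale (a : 'F_p) (x : W) : W := x *+ a.

Lemma Fp_space_mod (x : W) (n : nat) : x *+ (n %% p) = x *+ n.
Proof. by rewrite {2}(divn_eq n p) mulrnDr mulnC mulrnA pV mul0rn add0r. Qed.

Lemma Fp_scaleA a b x : Fp_scale a (Fp_scale b x) = Fp_scale (a * b) x.
Proof.
by rewrite /Fp_scale /= -mulrnA [X in (_ %% X)%N]Fp_cast // Fp_space_mod mulnC.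
Qed.
Lemma Fp_scale1 : left_id 1 Fp_scale.
Proof. by move=> x; rewrite /Fp_scale /= mulr1n. Qed.
Lemma Fp_scaleDr : right_distributive Fp_scale +%R.
Proof. by move=> a x y; rewrite /Fp_scale mulrnDl. Qed.
Lemma Fp_scaleDl x : {morph Fp_scale^~ x : a b / a + b}.
Proof.
by move=> a b; rewrite /Fp_scale /= [X in (_ %% X)%N]Fp_cast // Fp_space_mod mulrnDr.
Qed.

HB.instance Definition _ := GRing.Zmodule_isLmodule.Build 'F_p W
  Fp_scaleA Fp_scale1 Fp_scaleDr Fp_scaleDl.
End FpSpace.

(* A normalized discrete valuation on L whose residue field has
   characteristic p.  The value at 0 is irrelevant. *)
Record dvaluation (p : nat) (L : fieldType) := DValuation {
  dval :> L -> int;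
  dvalM : forall x y, x != 0 -> y != 0 -> dval (x * y) = dval x + dval y;
  dvalD : forall x y, x != 0 -> y != 0 -> x + y != 0 ->
    Num.min (dval x) (dval y) <= dval (x + y);
  dval_surj : exists x, (x != 0) && (dval x == 1);
  dval_p : (p%:R == 0 :> L) || (0 < dval p%:R)
}.

Section Valuation.
Variables (p : nat) (L : fieldType) (v : dvaluation p L).

Definition vge (n : int) (x : L) : bool := (x == 0) || (n <= v x).

Definition vring : {pred L} := vge 0.

Definition vmax : {pred L} := vge 1.

Definition is_uniformizer (x : L) : bool := (x != 0) && (v x == 1).

Definition uniformizer : L := xchoose (dval_surj v).

Lemma dval1 : v 1 = 0.
Proof.
by apply: (addrI (v 1)); rewrite -dvalM ?oner_neq0 // mulr1 addr0.
Qed.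

Lemma vgeD n x y : vge n x -> vge n y -> vge n (x + y).
Proof.
rewrite /vge; case: (eqVneq x 0) => [->|x0] /=; first by rewrite add0r.
case: (eqVneq y 0) => [->|y0] /=; first by rewrite addr0 => ->; rewrite orbT.
move=> vx vy; case: (eqVneq (x + y) 0) => //= xy0.
by apply: le_trans (dvalD v x0 y0 xy0); rewrite le_min vx.
Qed.

Lemma dvalN1 : v (-1) = 0.
Proof.
have n1 : -1 != 0 :> L by rewrite oppr_eq0 oner_eq0.
have : v (-1) *+ 2 = 0 by rewrite mulr2n -dvalM // mulN1r opprK dval1.
by move/eqP; rewrite mulrn_eq0 /= => /eqP.
Qed.

Lemma dvalX x n : x != 0 -> v (x ^+ n) = v x *+ n.
Proof.
move=> x0; elim: n => [|n IHn]; first by rewrite expr0 dval1.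
by rewrite exprS dvalM ?expf_neq0 // IHn mulrS.
Qed.

Lemma vgeM m n x y : vge m x -> vge n y -> vge (m + n) (x * y).
Proof.
rewrite /vge mulf_eq0.
case: (eqVneq x 0) => //= x0; case: (eqVneq y 0) => //= y0 vx vy.
by rewrite dvalM // lerD.
Qed.

Lemma vgeN n x : vge n x -> vge n (- x).
Proof.
move=> vx; rewrite -mulN1r -[n]add0r; apply: vgeM => //.
by rewrite /vge dvalN1 lexx orbT.
Qed.

Lemma vge1_0 x : x \in vmax -> x \in vring.
Proof.
by rewrite !unfold_in /vge => /orP[-> //|vx]; rewrite (le_trans _ vx) ?orbT.
Qed.

Lemma vring_closed : subring_closed vring.
Proof.
split=> [|x y vx vy|x y vx vy].
- by rewrite unfold_in /vge dval1 lexx orbT.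
- by apply: vgeD => //; apply: vgeN.
- by rewrite /vring -[0]addr0; apply: vgeM.
Qed.
HB.instance Definition _ := GRing.isSubringClosed.Build L vring vring_closed.

Record valuation_ring := ValuationRing {
  vr_val : L; vr_valP : vr_val \in vring }.
HB.instance Definition _ := [isSub for vr_val].
HB.instance Definition _ := [Choice of valuation_ring by <:].
HB.instance Definition _ :=
  [SubChoice_isSubComNzRing of valuation_ring by <:].

Definition maximal_ideal : {pred valuation_ring} := fun x => val x \in vmax.

Lemma maximal_ideal_closed : idealr_closed maximal_ideal.
Proof.
split.
- by rewrite -[_ \in _]/(vge 1 (0 : L)) /vge eqxx.
- by rewrite -[_ \in _]/(vge 1 (1 : L)) /vge dval1 oner_eq0.
- move=> a x y mx my; apply: (@vgeD 1 (val a * val x) (val y)) => //.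
  by rewrite -[X in vge X]add0r; apply: vgeM => //; exact: valP.
Qed.
HB.instance Definition _ :=
  isIdealr.Build valuation_ring maximal_ideal maximal_ideal_closed.

Definition residue : Type := {ideal_quot maximal_ideal}.
HB.instance Definition _ := GRing.ComNzRing.on residue.

(* Reduction O_L -> O_L / m_L, with value 0 outside O_L. *)
Definition red (x : L) : residue :=
  \pi_({ideal_quot maximal_ideal})%qT (insubd (0 : valuation_ring) x).

Definition residue_card : nat := #|` fset_set [set: residue] |%fset.

Lemma redE x (vx : x \in vring) :
  red x = \pi_({ideal_quot maximal_ideal})%qT (ValuationRing vx).
Proof. by rewrite /red /insubd insubT. Qed.

Lemma redD x y : x \in vring -> y \in vring -> red (x + y) = red x + red y.
Proof.
move=> vx vy; rewrite (redE (rpredD vx vy)) (redE vx) (redE vy).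
by rewrite -rmorphD; congr (\pi_ _)%qT; apply: val_inj.
Qed.

Lemma redM x y : x \in vring -> y \in vring -> red (x * y) = red x * red y.
Proof.
move=> vx vy; rewrite (redE (rpredM vx vy)) (redE vx) (redE vy).
by rewrite -rmorphM; congr (\pi_ _)%qT; apply: val_inj.
Qed.

Lemma red1 : red 1 = 1.
Proof.
rewrite (redE (rpred1 _)) -(rmorph1 (\pi_({ideal_quot maximal_ideal}))%qT).
by congr (\pi_ _)%qT; apply: val_inj.
Qed.

Lemma redX x n : x \in vring -> red (x ^+ n) = red x ^+ n.
Proof.
move=> vx; elim: n => [|n IHn]; first by rewrite !expr0 red1.
by rewrite !exprS redM ?rpredX // IHn.
Qed.

Lemma red_eq x y : x \in vring -> y \in vring ->
  (red x == red y) = (x - y \in vmax).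
Proof. by move=> vx vy; rewrite (redE vx) (redE vy) -Quotient.idealrBE. Qed.

Lemma red_surj (a : residue) : exists2 x, x \in vring & a = red x.
Proof.
case: (generic_quotient.repr a) (reprK a) => x vx <-.
by exists x => //; rewrite (redE vx).
Qed.

Lemma residue_pchar : prime p -> p \in [pchar residue].
Proof.
move=> p_pr; rewrite inE p_pr /=.
have -> : (p%:R : residue) = red p%:R.
  elim: p => [|n IHn]; last by rewrite !mulrS IHn redD ?red1 ?rpred1 ?rpred_nat.
  rewrite (redE (rpred0 _)) !mulr0n.
  rewrite -(rmorph0 (\pi_({ideal_quot maximal_ideal}))%qT).
  by congr (\pi_ _)%qT; apply: val_inj.
have -> : 0 = red 0.
  rewrite (redE (rpred0 _)).
  rewrite -(rmorph0 (\pi_({ideal_quot maximal_ideal}))%qT).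
  by congr (\pi_ _)%qT; apply: val_inj.
by rewrite red_eq ?rpred_nat ?rpred0 // subr0; exact: dval_p.
Qed.

Definition vcauchy (u : nat -> L) : Prop :=
  forall n : int, exists N : nat, forall i j : nat,
    (N <= i)%N -> (N <= j)%N -> vge n (u i - u j).

Definition vcvg (u : nat -> L) (l : L) : Prop :=
  forall n : int, exists N : nat, forall i : nat,
    (N <= i)%N -> vge n (u i - l).

Definition vcomplete : Prop := forall u, vcauchy u -> exists l, vcvg u l.

End Valuation.

Definition padic_val (p : nat) (r : rat) : int :=
  (logn p `|numq r|%N)%:Z - (logn p `|denq r|%N)%:Z.

(* (L, v) is a completion of the field of rational numbers with respect to the
   p-adic valuation, i.e. L is "the" field Q_p. *)
Record is_Qp (p : nat) (L : fieldType) (v : dvaluation p L) : Prop := IsQp {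
  Qp_char0 : [pchar L] =i pred0;
  Qp_extends : forall r : rat, r != 0 -> v (ratr r) = padic_val p r;
  Qp_dense : forall (x : L) (n : int), exists r : rat, vge v n (x - ratr r);
  Qp_complete : vcomplete v
}.

Definition lies_over (p : nat) (K : fieldType) (F : fieldExtType K)
    (v : dvaluation p K) (w : dvaluation p F) : Prop :=
  forall x : K, (x%:A \in vring w) = (x \in vring v).

Definition ramification_index (p : nat) (K : fieldType) (F : fieldExtType K)
    (v : dvaluation p K) (w : dvaluation p F) : nat :=
  `|w (uniformizer v)%:A|%N.

Definition absolute_ramification_index (p : nat) (F : fieldType)
  (w : dvaluation p F) : nat := `|w p%:R|%N.

Section Galois.
Variables (p : nat) (K : fieldType) (F : splittingFieldType K).
Local Notation gT := (gal_of {:F}).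
Local Notation H := 'Gal({:F} / 1)%G.

Section PowerClasses.

(* F^*, written additively. *)
Record mul_group := MulGroup { mg_val : F; mg_valP : mg_val != 0 }.
HB.instance Definition _ := [isSub for mg_val].
HB.instance Definition _ := [Choice of mul_group by <:].

Definition mg_one := MulGroup (oner_neq0 F).
Definition mg_mul (x y : mul_group) : mul_group :=
  MulGroup (mulf_neq0 (mg_valP x) (mg_valP y)).
Definition mg_inv (x : mul_group) : mul_group :=
  MulGroup (invr_neq0 (mg_valP x)).

Lemma mg_mulA : associative mg_mul.
Proof. by move=> x y z; apply: val_inj; rewrite /= mulrA. Qed.
Lemma mg_mulC : commutative mg_mul.
Proof. by move=> x y; apply: val_inj; rewrite /= mulrC. Qed.
Lemma mg_mul1 : left_id mg_one mg_mul.
Proof. by move=> x; apply: val_inj; rewrite /= mul1r. Qed.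
Lemma mg_mulV : left_inverse mg_one mg_inv mg_mul.
Proof. by move=> x; apply: val_inj; rewrite /= mulVf // mg_valP. Qed.
HB.instance Definition _ :=
  GRing.isZmodule.Build mul_group mg_mulA mg_mulC mg_mul1 mg_mulV.

Lemma mg_valX (x : mul_group) n : val (x *+ n) = val x ^+ n.
Proof. by elim: n => // n IHn; rewrite mulrS exprS -IHn. Qed.

Lemma gal_neq0 (s : gT) (x : F) : x != 0 -> s x != 0.
Proof. by rewrite fmorph_eq0. Qed.

Definition mg_gal (s : gT) (x : mul_group) : mul_group :=
  MulGroup (gal_neq0 s (mg_valP x)).

Definition mg_powers : {pred mul_group} :=
  fun x => `[< exists y : mul_group, val x = val y ^+ p >].

Lemma mg_powers_closed : zmod_closed mg_powers.
Proof.
split=> [|x y /asboolP[x' xE] /asboolP[y' yE]]; apply/asboolP.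
  by exists 0; rewrite /= expr1n.
by exists (x' - y'); rewrite /= xE yE exprMn exprVn.
Qed.
HB.instance Definition _ :=
  GRing.isZmodClosed.Build mul_group mg_powers mg_powers_closed.

(* F^* / (F^* )^p, written additively. *)
Definition power_classes_zmod : Type := Quotient.quot mg_powers.
HB.instance Definition _ := GRing.Zmodule.on power_classes_zmod.

Lemma power_classes_p (x : power_classes_zmod) : x *+ p = 0.
Proof.
rewrite -[x](@reprK _ (Quotient.quot mg_powers)); move: (generic_quotient.repr _) => y.
rewrite -raddfMn -(raddf0 (\pi_(Quotient.quot mg_powers))%qT).
apply/eqP; rewrite -Quotient.idealrBE subr0; apply/asboolP.
by exists y; rewrite mg_valX.
Qed.

Variable p_pr : prime p.

Definition power_classes : Type := Fp_space p_pr power_classes_p.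
HB.instance Definition _ := GRing.Lmodule.on power_classes.

Definition power_class (x : mul_group) : power_classes :=
  \pi_(Quotient.quot mg_powers)%qT x.

Definition power_classes_fun (s : gT) (c : power_classes) : power_classes :=
  power_class (mg_gal s (generic_quotient.repr (c : Quotient.quot mg_powers))).

Lemma power_classP (x y : mul_group) :
  power_class x = power_class y <->
  exists z : mul_group, val x = val y * val z ^+ p.
Proof.
rewrite /power_class; split=> [/eqP|[z xyz]].
  rewrite -Quotient.idealrBE => /asboolP[z /= xyz]; exists z.
  by rewrite -xyz mulrCA divff ?mulr1 // mg_valP.
apply/eqP; rewrite -Quotient.idealrBE; apply/asboolP; exists z => /=.
by rewrite xyz mulrAC divff ?mul1r // mg_valP.
Qed.

Lemma power_classD (x y : mul_group) :
  power_class (x + y) = power_class x + power_class y.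
Proof. exact: (raddfD (\pi_(Quotient.quot mg_powers))%qT). Qed.

Lemma power_class_surj (c : power_classes) : exists x, c = power_class x.
Proof.
exists (generic_quotient.repr (c : Quotient.quot mg_powers)).
by rewrite /power_class reprK.
Qed.

Lemma power_classes_funE s x :
  power_classes_fun s (power_class x) = power_class (mg_gal s x).
Proof.
have [y [-> ]]: exists y, power_classes_fun s (power_class x) =
    power_class (mg_gal s y) /\ power_class y = power_class x.
  exists (generic_quotient.repr (power_class x : Quotient.quot mg_powers)).
  by split=> //; rewrite /power_class reprK.
move=> /power_classP[z yxz]; apply/power_classP; exists (mg_gal s z).
by rewrite /= yxz rmorphM rmorphXn.
Qed.

Lemma power_classes_linear s : s \in H -> linear (power_classes_fun s).
Proof.
move=> _ a c d; have [x ->] := power_class_surj c.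
have [y ->] := power_class_surj d.
have sMn (n : nat) z : power_classes_fun s (power_class z *+ n) =
    power_classes_fun s (power_class z) *+ n.
  have classMn w : power_class w *+ n = power_class (w *+ n).
    elim: n => [|n IHn]; last by rewrite !mulrS power_classD IHn.
    exact: (esym (raddf0 (\pi_(Quotient.quot mg_powers))%qT)).
  rewrite classMn !power_classes_funE classMn; congr power_class.
  by apply: val_inj; rewrite /= !mg_valX /= rmorphXn.
have sD z w : power_classes_fun s (power_class z + power_class w) =
    power_classes_fun s (power_class z) + power_classes_fun s (power_class w).
  rewrite -power_classD !power_classes_funE -power_classD; congr power_class.
  by apply: val_inj; rewrite /= rmorphM.
have [z zE] := power_class_surj (a *: power_class x).
by rewrite zE sD -zE [in LHS]/GRing.scale /= sMn.
Qed.

Lemma power_classes_one c : power_classes_fun 1%g c = c.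
Proof.
have [x ->] := power_class_surj c; rewrite power_classes_funE.
by congr power_class; apply: val_inj; rewrite /= gal_id.
Qed.

Lemma power_classes_mul s t : s \in H -> t \in H -> forall c,
  power_classes_fun (s * t)%g c = power_classes_fun t (power_classes_fun s c).
Proof.
move=> _ _ c; have [x ->] := power_class_surj c; rewrite !power_classes_funE.
by congr power_class; apply: val_inj; rewrite /= galM ?memvf.
Qed.

Definition power_classes_action : FpH_action H power_classes :=
  FpHAction power_classes_linear power_classes_one power_classes_mul.

End PowerClasses.

Section Cyclotomic.
Variables (zp : F).

(* zp is meant to be a primitive p-th root of unity. *)
Definition cyclotomic (s : gT) : 'F_p :=
  odflt 0 [pick a : 'F_p | s zp == zp ^+ a].

Hypotheses (p_pr : prime p) (zpP : p.-primitive_root zp).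

Lemma zp_mod (n : nat) : zp ^+ (n %% p) = zp ^+ n.
Proof. exact: (prim_expr_mod zpP). Qed.

Lemma cyclotomicP (s : gT) : s zp = zp ^+ cyclotomic s.
Proof.
rewrite /cyclotomic; case: pickP => [a /eqP //|] noa.
have : s zp ^+ p = 1 by rewrite -rmorphXn (prim_expr_order zpP) rmorph1.
move/(prim_rootP zpP) => [i szp].
have := noa (i%:R); rewrite val_Fp_nat // zp_mod szp eqxx.
by [].
Qed.

Lemma cyclotomic_unique (s : gT) (a : 'F_p) : s zp = zp ^+ a -> cyclotomic s = a.
Proof.
rewrite cyclotomicP => /eqP; rewrite (eq_prim_root_expr zpP) => /eqP E.
by apply: val_inj; move: E; rewrite !modn_small // -[X in (_ < X)%N](Fp_cast p_pr).
Qed.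

Lemma cyclotomic_linear s : s \in H ->
  linear (fun x : ('F_p)^o => cyclotomic s * x : ('F_p)^o).
Proof. by move=> _ a x y; rewrite mulrDr /GRing.scale /= mulrCA. Qed.

Lemma cyclotomic_one (x : ('F_p)^o) : cyclotomic 1%g * x = x.
Proof.
by rewrite (@cyclotomic_unique _ 1) ?mul1r // gal_id expr1.
Qed.

Lemma cyclotomicM (s t : gT) :
  cyclotomic (s * t)%g = cyclotomic t * cyclotomic s.
Proof.
apply: cyclotomic_unique.
rewrite galM ?memvf // (cyclotomicP s) rmorphXn /= (cyclotomicP t) -exprM.
by rewrite [X in (_ %% X)%N]Fp_cast // zp_mod.
Qed.

Lemma cyclotomic_mul s t : s \in H -> t \in H -> forall x : ('F_p)^o,
  cyclotomic (s * t)%g * x = cyclotomic t * (cyclotomic s * x).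
Proof. by move=> _ _ x; rewrite cyclotomicM mulrA. Qed.

Definition cyclotomic_action : FpH_action H ('F_p)^o :=
  FpHAction cyclotomic_linear cyclotomic_one cyclotomic_mul.

End Cyclotomic.

Section Residue.
Variables (vK : dvaluation p K) (vF : dvaluation p F).
Local Notation e := (ramification_index vK vF).
Local Notation q := (residue_card vK).

(* Automorphisms in H acting trivially on the residue field of F. *)
Definition inertia : {set gT} :=
  [set s in H | `[< forall x, x \in vring vF -> s x - x \in vmax vF >]].

(* The splitting H = <tau> ><| <ups> together with the uniformizer of the
   fixed field of <ups> used to define the modules M_i. *)
Record splitting := Splitting {
  tau : gT;
  ups : gT;
  tau_inertia : <[tau]>%g = inertia;
  ups_frobenius : forall x, x \in vring vF -> ups x - x ^+ q \in vmax vF;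
  tau_ups : (<[tau]> ><| <[ups]>)%g = H;
  unif : F;
  unif_fixed : unif \in fixedField <[ups]>%g;
  unif_uniformizer : is_uniformizer vF unif;
  unif_root : exists2 w : K, is_uniformizer vK w & unif ^+ e = w%:A
}.

Variables (p_pr : prime p) (S : splitting).
Local Notation t := (tau S).
Local Notation u := (ups S).
Local Notation pi := (unif S).

Definition residue_space : Type := pPrimeCharType (residue_pchar vF p_pr).
HB.instance Definition _ := GRing.Lmodule.on residue_space.
HB.instance Definition _ := GRing.ComNzRing.on residue_space.

Definition zeta_bar : residue_space := red vF (t pi / pi).

Definition M_tau (i : nat) (x : residue_space) : residue_space :=
  zeta_bar ^+ i * x.

Definition M_ups (x : residue_space) : residue_space := x ^+ q.

(* The action of H on M_i determined by those of tau and ups (see [M_actionE]).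
   Every element of H is tau^a o ups^b for some a, b; in MathComp's order of
   composition this is ups ^+ b * tau ^+ a. *)
Definition M_fun (i : nat) (s : gT) (x : residue_space) : residue_space :=
  if [pick ab : 'I_#[t]%g * 'I_#[u]%g | s == (u ^+ ab.2 * t ^+ ab.1)%g]
  is Some (a, b) then iter a (M_tau i) (iter b M_ups x) else x.

Lemma unif_neq0 : pi != 0.
Proof. by have /andP[] := unif_uniformizer S. Qed.

Lemma ups_vring k x : x \in vring vF ->
  [/\ (u ^+ k)%g x \in vring vF & red vF ((u ^+ k)%g x) = iter k M_ups (red vF x)].
Proof.
elim: k => [|k IHk] vx; first by rewrite expg0 gal_id.
have [vy yE] := IHk vx; rewrite expgSr galM ?memvf //=.
have uy := ups_frobenius S vy.
have vuy : u ((u ^+ k)%g x) \in vring vF.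
  rewrite -[X in X \in _](subrK ((u ^+ k)%g x ^+ q)) rpredD ?rpredX //.
  exact: vge1_0.
split=> //; rewrite -yE /M_ups -redX //; apply/eqP.
by rewrite red_eq // rpredX.
Qed.

Lemma tau_vring a x : x \in vring vF ->
  (t ^+ a)%g x \in vring vF /\ red vF ((t ^+ a)%g x) = red vF x.
Proof.
move=> vx; have : (t ^+ a)%g \in inertia by rewrite -(tau_inertia S) mem_cycle.
rewrite inE => /andP[_ /asboolP/(_ x vx) tx].
have vtx : (t ^+ a)%g x \in vring vF.
  by rewrite -[X in X \in _](subrK x) rpredD //; apply: vge1_0.
by split=> //; apply/eqP; rewrite red_eq.
Qed.

Lemma ramification_gt0 : (0 < e)%N.
Proof.
have [w /andP[w0 /eqP vw] piw] := unif_root S.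
rewrite lt0n; apply/eqP => e0; move: piw; rewrite e0 expr0 => w1.
suff w1' : w = 1 by move: vw; rewrite w1' dval1.
by apply: (fmorph_inj (in_alg F)); rewrite rmorph1 /= -w1.
Qed.

Lemma root_ratio (s : gT) : s pi / pi \in vring vF.
Proof.
have [w /andP[w0 /eqP vw] piw] := unif_root S.
have z0 : s pi / pi != 0 by rewrite mulf_eq0 invr_eq0 fmorph_eq0 orbb unif_neq0.
have ze : (s pi / pi) ^+ e = 1.
  rewrite exprMn exprVn -rmorphXn /= piw linearZ /= rmorph1 divff //.
  by rewrite -piw expf_neq0 // unif_neq0.
have := dvalX vF e z0; rewrite ze dval1 => /esym/eqP.
rewrite mulrn_eq0 eqn0Ngt ramification_gt0 /= => /eqP vz.
by rewrite /vring unfold_in /vge vz lexx orbT.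
Qed.

Lemma zeta_barX a : red vF ((t ^+ a)%g pi / pi) = zeta_bar ^+ a.
Proof.
elim: a => [|a IHa]; first by rewrite expg0 gal_id divff ?unif_neq0 // red1.
have -> : (t ^+ a.+1)%g pi / pi = t ((t ^+ a)%g pi / pi) * (t pi / pi).
  rewrite expgSr galM ?memvf // fmorph_div /= mulrA divfK //.
  by rewrite fmorph_eq0 unif_neq0.
have [] := tau_vring 1 (root_ratio (t ^+ a)%g); rewrite expg1 => vt tE.
by rewrite redM ?root_ratio // tE IHa exprSr.
Qed.

Lemma iter_M_tau i a x : iter a (M_tau i) x = (zeta_bar ^+ a) ^+ i * x.
Proof.
elim: a => [|a IHa]; first by rewrite expr0 expr1n mul1r.
by rewrite iterS IHa /M_tau mulrA exprS exprMn.
Qed.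

Lemma split_gal (s : gT) : s \in H ->
  exists ab : 'I_#[t]%g * 'I_#[u]%g, s = (u ^+ ab.2 * t ^+ ab.1)%g.
Proof.
move=> Hs; have [_ tuH _ _] := sdprodP (tau_ups S).
have : (s^-1)%g \in (<[t]> * <[u]>)%g by rewrite tuH groupV.
case/mulsgP=> x y tx uy sE; move: tx uy; rewrite -groupV -(groupV _ y).
case/cyclePmin=> a a_lt xE; case/cyclePmin=> b b_lt yE.
exists (Ordinal a_lt, Ordinal b_lt) => /=.
by rewrite -xE -yE -invMg -sE invgK.
Qed.

Lemma M_funE i s x : s \in H -> x \in vring vF ->
  s x \in vring vF /\
  M_fun i s (red vF x) = red vF ((s pi / pi) ^+ i * s x).
Proof.
move=> Hs vx.
have key (a b : nat) : s = (u ^+ b * t ^+ a)%g -> s x \in vring vF /\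
    iter a (M_tau i) (iter b M_ups (red vF x)) =
    red vF ((s pi / pi) ^+ i * s x).
  move=> ->; have [vux uE] := ups_vring b vx.
  have [vtx tE] := tau_vring a vux.
  rewrite !galM ?memvf //; split=> //.
  have -> : (u ^+ b)%g pi = pi.
    by have /mem_fixedFieldP[_ ->] := unif_fixed S; rewrite ?mem_cycle.
  by rewrite redM ?rpredX ?root_ratio // redX ?root_ratio // zeta_barX tE uE
             iter_M_tau.
split; first by have [[a b] /= /key[]] := split_gal Hs.
rewrite /M_fun; case: pickP => [[a b] /= /eqP /key[] //|noab].
by have [ab sE] := split_gal Hs; have := noab ab; rewrite -sE eqxx.
Qed.

Lemma tau_H : t \in H.
Proof.
have : t \in inertia by rewrite -(tau_inertia S) cycle_id.
by rewrite inE => /andP[].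
Qed.

Lemma ups_H : u \in H.
Proof.
have [_ <- _ _] := sdprodP (tau_ups S).
by rewrite -[X in X \in _]mul1g mem_mulg ?group1 ?cycle_id.
Qed.

Lemma M_linear i s : s \in H -> linear (M_fun i s).
Proof.
move=> Hs c x y.
have MD x' y' : M_fun i s (x' + y') = M_fun i s x' + M_fun i s y'.
  have [a va ->] := red_surj x'; have [b vb ->] := red_surj y'.
  have [vsa aE] := M_funE i Hs va; have [vsb bE] := M_funE i Hs vb.
  rewrite aE bE -[red vF a + _]redD // (M_funE i Hs (rpredD va vb)).2.
  by rewrite rmorphD mulrDr redD // rpredM ?rpredX ?root_ratio.
have M0 : M_fun i s 0 = 0 by apply: (addrI (M_fun i s 0)); rewrite -MD !addr0.
have MMn x' n : M_fun i s (x' *+ n) = M_fun i s x' *+ n.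
  by elim: n => // n IHn; rewrite !mulrS MD IHn.
have scE (d : 'F_p) (x' : residue_space) : d *: x' = x' *+ d.
  by rewrite -mulr_natl.
by rewrite MD !scE MMn.
Qed.

Lemma M_one i x : M_fun i 1%g x = x.
Proof.
have [y vx ->] := red_surj x.
by rewrite (M_funE _ _ vx).2 ?group1 // !gal_id divff ?unif_neq0 // expr1n mul1r.
Qed.

Lemma M_mul i s s' : s \in H -> s' \in H ->
  forall x, M_fun i (s * s')%g x = M_fun i s' (M_fun i s x).
Proof.
move=> Hs Hs' x; have [y vx ->] := red_surj x.
have [vsx ->] := M_funE i Hs vx.
have vy : (s pi / pi) ^+ i * s y \in vring vF by rewrite rpredM ?rpredX ?root_ratio.
rewrite (M_funE i Hs' vy).2 (M_funE i (groupM Hs Hs') vx).2.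
rewrite !galM ?memvf // rmorphM rmorphXn fmorph_div /= mulrA -exprMn.
by rewrite [_ / _ * (_ / _)]mulrC mulrA divfK // fmorph_eq0 unif_neq0.
Qed.

Definition M_action (i : nat) : FpH_action H residue_space :=
  FpHAction (@M_linear i) (@M_one i) (@M_mul i).

Lemma M_actionE (i : nat) (x : residue_space) :
  M_action i t x = zeta_bar ^+ i * x /\ M_action i u x = x ^+ q.
Proof.
have [y vx ->] := red_surj x; rewrite /= (M_funE i tau_H vx).2.
rewrite (M_funE i ups_H vx).2; split.
  have [vtx tE] := tau_vring 1 vx; move: vtx tE; rewrite expg1 => vtx tE.
  by rewrite redM ?rpredX ?root_ratio // redX ?root_ratio // tE.
have -> : u pi = pi.
  by have /mem_fixedFieldP[_ ->] := unif_fixed S; rewrite ?cycle_id.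
have [_ uE] := ups_vring 1 vx.
rewrite -[RHS]/(iter 1 M_ups (red vF y)) -uE expg1.
by rewrite divff ?unif_neq0 // expr1n mul1r.
Qed.

End Residue.
End Galois.

(* I_F = p e_F / (p - 1); the quotient is exact as soon as F contains a
   primitive p-th root of unity. *)
Definition I_bound (p : nat) (F : fieldType) (w : dvaluation p F) : nat :=
  (p * absolute_ramification_index w) %/ p.-1.

Definition prime_to_p_interval (p : nat) (F : fieldType) (w : dvaluation p F)
  : finType := {i : 'I_(I_bound w).+1 | coprime i p}.

(* Main.v *)
(* Filter the power classes by the images of the unit groups U_n.  With
   lam = zp - 1 and r = v(lam) one has v(p) = (p - 1) r and lam^(p-1) = -p (1 + ...),
   so I_F = p r.  Expanding (1 + z)^p = 1 + z^p + p z (...) shows that U_n is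
   contained in F^p for n > p r (F is complete), that U_n and U_(n+1) have the same
   image for n < p r divisible by p, that U_n / U_(n+1) survives and is M_n for
   n < p r prime to p, and that the classes 1 + lam^p b of level p r are p-th powers
   exactly when b = c^p - c modulo the maximal ideal.  That last quotient of the
   residue field is a line on which H acts through the cyclotomic character.
   The class of the uniformizer is invariant: the quotient of a conjugate of it by
   itself is a root of unity of order prime to p.
   Since tau has order prime to p and the Frobenius acts on the residue field with
   nonzero trace, each M_n is projective: an F_p-linear lift M_n -> F^*/(F^* )^p
   can be averaged over H against an element of trace one.  The filtration
   therefore splits H-equivariantly. *)
From HB Require Import structures.
Require Import Defs.
From mathcomp Require Import all_boot all_order all_algebra all_fingroup.
From mathcomp Require Import all_solvable all_field.
From mathcomp Require Import boolp classical_sets cardinality ring_quotient finmap zify ring.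

Set Implicit Arguments.
Unset Strict Implicit.
Unset Printing Implicit Defensive.

Import Order.TTheory GRing.Theory Num.Theory.

Local Open Scope ring_scope.

(** * Discrete valuations and their residue fields *)

Section ValuationTheory.
Variables (p : nat) (L : fieldType) (v : dvaluation p L).
Implicit Types (x y z : L) (n m : int).

Lemma vge0 n : vge v n 0. Proof. by rewrite /vge eqxx. Qed.

Lemma vge_le m n x : m <= n -> vge v n x -> vge v m x.
Proof. by move=> mn /orP[/eqP->|/(le_trans mn) mx]; rewrite /vge ?eqxx ?mx ?orbT. Qed.

Lemma vge_vring n x : 0 <= n -> vge v n x -> x \in vring v.
Proof. exact: vge_le. Qed.

Lemma vringE x : (x \in vring v) = vge v 0 x. Proof. by []. Qed.

Lemma vmaxE x : (x \in vmax v) = vge v 1 x. Proof. by []. Qed.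

Lemma vge_neq0 n x : x != 0 -> vge v n x = (n <= v x).
Proof. by rewrite /vge => /negbTE->. Qed.

Lemma vgeB n x y : vge v n x -> vge v n y -> vge v n (x - y).
Proof. by move=> vx vy; apply: vgeD => //; apply: vgeN. Qed.

Lemma vgeBC n x y : vge v n (x - y) = vge v n (y - x).
Proof. by apply/idP/idP => /vgeN; rewrite opprB. Qed.

Lemma vge_addr n x y : vge v n y -> vge v n (x + y) = vge v n x.
Proof.
move=> vy; apply/idP/idP => [vxy|vx]; last exact: vgeD.
by rewrite -[x](addrK y); apply: vgeB.
Qed.

Lemma vge_trans n x y z : vge v n (x - y) -> vge v n (y - z) -> vge v n (x - z).
Proof. by move=> xy yz; rewrite -[x](subrK y) -addrA; apply: vgeD. Qed.

Lemma vgeMl n a x : a \in vring v -> vge v n x -> vge v n (a * x).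
Proof. by move=> va vx; rewrite -[n]add0r; apply: vgeM. Qed.

Lemma vgeMr n a x : a \in vring v -> vge v n x -> vge v n (x * a).
Proof. by move=> va vx; rewrite mulrC; apply: vgeMl. Qed.

Lemma dvalV x : x != 0 -> v x^-1 = - v x.
Proof.
by move=> x0; apply: (addrI (v x)); rewrite -dvalM ?invr_eq0 // divff // dval1 subrr.
Qed.

Lemma dvalN x : v (- x) = v x.
Proof.
have [->|x0] := eqVneq x 0; first by rewrite oppr0.
by rewrite -mulN1r dvalM ?oppr_eq0 ?oner_eq0 // dvalN1 add0r.
Qed.

Lemma vgeX n x k : vge v n x -> vge v (n *+ k) (x ^+ k).
Proof.
move=> vx; elim: k => [|k IHk]; first by rewrite expr0 mulr0n; exact: (rpred1 (vring v)).
by rewrite exprS mulrS; apply: vgeM.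
Qed.

Lemma vge_mul2l n y x : y != 0 -> vge v (v y + n) (y * x) = vge v n x.
Proof.
move=> y0; rewrite /vge mulf_eq0 (negbTE y0) /=.
by have [//|x0] := eqVneq x 0; rewrite dvalM // lerD2l.
Qed.

Lemma vge_div n y x : y != 0 -> vge v (v y + n) x = vge v n (x / y).
Proof. by move=> y0; rewrite -[RHS](vge_mul2l n _ y0) mulrCA divff // mulr1. Qed.

Lemma vge_quot y x : y != 0 -> vge v (v y) x = (x / y \in vring v).
Proof. by move=> y0; rewrite -[v y]addr0 vge_div. Qed.

Lemma vge_all0 x : (forall n : nat, vge v n x) -> x = 0.
Proof.
move=> vx; apply/eqP/negPn/negP => x0; have := vx `|v x|.+1.
by rewrite vge_neq0 //; lia.
Qed.

Lemma dval_eq n x : vge v n x -> ~~ vge v (n + 1) x -> x != 0 /\ v x = n.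
Proof.
move=> vx; have [->|x0] := eqVneq x 0; first by rewrite vge0.
by move: vx; rewrite !vge_neq0 //; lia.
Qed.

Lemma vgeNS x : x != 0 -> ~~ vge v (v x + 1) x.
Proof. by move=> x0; rewrite vge_neq0 //; lia. Qed.

Lemma vge_red0 x : x \in vring v -> (red v x == 0) = vge v 1 x.
Proof.
have -> : 0 = red v 0.
  by apply: (addrI (red v 0)); rewrite -redD ?rpred0 // !addr0.
by move=> vx; rewrite red_eq ?rpred0 // subr0.
Qed.

Lemma red0 : red v 0 = 0.
Proof. by apply/eqP; rewrite vge_red0 ?vge0 // rpred0. Qed.

Lemma redN x : x \in vring v -> red v (- x) = - red v x.
Proof.
move=> vx; apply: (addrI (red v x)).
by rewrite -redD ?rpredN // !subrr red0.
Qed.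

Lemma red_sum (I : Type) (r : seq I) (f : I -> L) : (forall i, f i \in vring v) ->
  red v (\sum_(i <- r) f i) = \sum_(i <- r) red v (f i).
Proof.
move=> vf; elim: r => [|i r IHr]; first by rewrite !big_nil red0.
by rewrite !big_cons redD ?IHr // rpred_sum.
Qed.

Lemma red_unit x : x \in vring v -> red v x != 0 -> x != 0 /\ v x = 0.
Proof. by move=> vx; rewrite vge_red0 // => /(dval_eq vx). Qed.

Lemma unit_vring x : v x = 0 -> x \in vring v.
Proof. by rewrite vringE /vge => ->; rewrite lexx orbT. Qed.

Lemma unit_red x : x != 0 -> v x = 0 -> red v x != 0.
Proof. by move=> x0 vx; rewrite vge_red0 ?unit_vring // vge_neq0 // vx. Qed.

Lemma vring1D_unit z : vge v 1 z -> 1 + z != 0 /\ v (1 + z) = 0.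
Proof.
move=> vz; have vz0 : z \in vring v by apply: vge_vring vz.
apply: dval_eq; first by apply: vgeD => //; exact: (rpred1 (vring v)).
by rewrite vge_addr // vge_neq0 ?oner_neq0 // dval1.
Qed.

(** A nonzero residue class consists of units, so any integral lift may be inverted and reduced;
    [xget] chooses one. *)
Definition res_inv (a : residue v) : residue v :=
  let x := xget 0 [set x | x \in vring v /\ a = red v x]%classic in
  if a == 0 then 0 else red v x^-1.

Lemma res_mulVf a : a != 0 -> res_inv a * a = 1.
Proof.
move=> a0; rewrite /res_inv (negbTE a0); case: xgetP => [x _ [vx ax]|noa]; last first.
  by have [x vx ax] := red_surj a; case: (noa x).
have [|x0 x_unit] := red_unit vx; first by rewrite -ax.
have vV : x^-1 \in vring v by rewrite unit_vring // dvalV // x_unit oppr0.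
by rewrite [X in _ * X]ax -redM // mulVf // red1.
Qed.

Lemma res_inv0 : res_inv 0 = 0. Proof. by rewrite /res_inv eqxx. Qed.

End ValuationTheory.

(* Aliases of [residue v], carrying the field structure and, when it is finite, the
   finite field structure. *)
Definition resfield (p : nat) (L : fieldType) (v : dvaluation p L) : Type := residue v.

HB.instance Definition _ (p : nat) (L : fieldType) (v : dvaluation p L) :=
  GRing.ComNzRing.on (resfield v).
HB.instance Definition _ (p : nat) (L : fieldType) (v : dvaluation p L) :=
  GRing.ComNzRing_isField.Build (resfield v) (@res_mulVf p L v) (@res_inv0 p L v).

Definition finresidue (p : nat) (L : fieldType) (v : dvaluation p L)
  (fin : finite_set [set: residue v]) : Type := resfield v.

Section FinResidue.
Variables (p : nat) (L : fieldType) (v : dvaluation p L).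
Variable fin : finite_set [set: residue v].
Local Notation kF := (finresidue fin).

HB.instance Definition _ := GRing.Field.on kF.

Definition res_enum : seq kF := undup (fset_set [set: residue v]).

Lemma mem_res_enum (a : kF) : a \in res_enum.
Proof. by rewrite mem_undup (in_fset_set fin) mem_set. Qed.

Lemma res_pickleK : pcancel (fun a : kF => index a res_enum)
  (fun n => nth None (map Some res_enum) n).
Proof.
by move=> a; rewrite (nth_map 0) ?index_mem ?mem_res_enum // nth_index ?mem_res_enum.
Qed.
HB.instance Definition _ := Countable.copy kF (pcan_type res_pickleK).

Lemma res_enumP : Finite.axiom res_enum.
Proof. by move=> a; rewrite count_uniq_mem ?undup_uniq // mem_res_enum. Qed.
HB.instance Definition _ := isFinite.Build kF res_enumP.

Lemma card_finresidue : #|{: kF}| = residue_card v.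
Proof.
rewrite cardT enumT unlock /= /res_enum undup_id ?fset_uniq //.
Qed.

End FinResidue.

(** * Completeness and its passage to a finite extension *)

Lemma posz_mulrn (c n : nat) : c%:Z *+ n = (n * c)%N.
Proof. by rewrite -mulr_natl natz. Qed.

Section Completeness.
Variables (p : nat) (L : fieldType) (v : dvaluation p L).

Lemma vseries_diff (c : nat) (u : nat -> L) :
  (forall n, vge v (n * c)%N (u n.+1 - u n)) ->
  forall n k, vge v (n * c)%N (u (n + k)%N - u n).
Proof.
move=> uS n; elim=> [|k IHk]; first by rewrite addn0 subrr vge0.
rewrite addnS; apply: vge_trans IHk; apply: vge_le (uS _).
by rewrite lez_nat leq_mul2r leq_addr orbT.
Qed.

(** By the ultrametric inequality, bounds on consecutive differences bound all later differences,
    and the limit keeps that rate. *)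
Lemma vseries_cvg (c : nat) (u : nat -> L) : vcomplete v -> (0 < c)%N ->
  (forall n, vge v (n * c)%N (u n.+1 - u n)) ->
  exists l, forall n, vge v (n * c)%N (u n - l).
Proof.
move=> v_complete c_gt0 /vseries_diff u_diff.
have diff n i : (n <= i)%N -> vge v (n * c)%N (u i - u n).
  by move=> ni; rewrite -(subnKC ni); apply: u_diff.
have [n|l ul] := v_complete u.
  exists `|n|%N => i j ni nj.
  have n_le : n <= (`|n|%N * c)%N by nia.
  apply: vge_le n_le _; apply: vge_trans (diff _ _ ni) _.
  by rewrite vgeBC; apply: diff.
exists l => n; have [N uN] := ul (n * c)%N.
have := uN (n + N)%N; rewrite leq_addl => /(_ isT); apply: vge_trans.
by rewrite vgeBC; apply: u_diff.
Qed.

Lemma vge_sum (I : Type) (r : seq I) (P : pred I) (f : I -> L) n :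
  (forall i, P i -> vge v n (f i)) -> vge v n (\sum_(i <- r | P i) f i).
Proof. by move=> fP; elim/big_ind: _ => //; [exact: vge0 | exact: vgeD]. Qed.

(** Expansion to n digits in a uniformizer [w], with digits lifting the finitely many residues. *)
Lemma vring_finite_mod (n : nat) : finite_set [set: residue v] ->
  exists2 s : seq L, {subset s <= vring v} &
    forall x, x \in vring v -> exists2 b, b \in s & vge v n (x - b).
Proof.
move=> fin; elim: n => [|n [s sv sP]].
  exists [:: 0] => [x|x vx]; first by rewrite inE => /eqP->; exact: rpred0.
  by exists 0; rewrite ?inE // subr0.
have [w /andP[w0 /eqP vw]] := dval_surj v.
have /choice[lift liftP] (a : residue v) : exists x, x \in vring v /\ a = red v x.
  by have [x] := red_surj a; exists x.
exists [seq r + w * b | r <- map lift (fset_set [set: residue v]), b <- s].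
  move=> _ /allpairsP[[_ b] /= [/mapP[a _ ->] bs ->]].
  have [va _] := liftP a; rewrite rpredD // vringE vgeMr ?sv //.
  by rewrite vge_neq0 // vw.
move=> x vx.
have [vr rE] := liftP (red v x).
have v1x : vge v 1 (x - lift (red v x)) by rewrite -vmaxE -red_eq // -rE.
have vy : (x - lift (red v x)) / w \in vring v by rewrite -vge_quot ?vw.
have [b bs bP] := sP _ vy; exists (lift (red v x) + w * b).
  apply/allpairsP; exists (lift (red v x), b); split=> //=.
  by rewrite map_f // (in_fset_set fin) mem_set.
have -> : x - (lift (red v x) + w * b) = w * ((x - lift (red v x)) / w - b).
  by field.
by rewrite -[n.+1%:Z]/(1 + n%:Z) -vw vge_mul2l.
Qed.

End Completeness.

Section CompleteExtension.
Variables (p : nat) (L : fieldType) (v : dvaluation p L).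

(* An element of the valuation ring is expanded in powers of [P] with digits in
   a finite set; grouping equal digits makes it a finite combination of the
   digits with coefficients in the complete subfield. *)
Lemma vcomplete_ext (k : fieldType) (vk : dvaluation p k)
    (iota : {rmorphism k -> L}) :
    vcomplete vk -> (p%:R != 0 :> k) ->
    (forall x, x \in vring vk -> iota x \in vring v) ->
  finite_set [set: residue v] -> vcomplete v.
Proof.
move=> k_complete pk0 iotaP fin u u_cauchy.
have pL0 : p%:R != 0 :> L by rewrite -(rmorph_nat iota) fmorph_eq0.
(* The values [c] and [ck] of p under the two valuations may differ by ramification; rates are
   compared through powers of p. Level [c] means divisibility by p. *)
have [c c_gt0 vpc]: exists2 c : nat, (0 < c)%N & v p%:R = c.
  by have /orP[/eqP/eqP/negPn/negP//|] := dval_p v; exists `|v p%:R|%N; lia.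
have [ck ck_gt0 vkpc]: exists2 c : nat, (0 < c)%N & vk p%:R = c.
  by have /orP[/eqP/eqP/negPn/negP//|] := dval_p vk; exists `|vk p%:R|%N; lia.
have vpX N : v (p%:R ^+ N) = (N * c)%N by rewrite dvalX // vpc posz_mulrn.
have vkpX N : vk (p%:R ^+ N) = (N * ck)%N by rewrite dvalX // vkpc posz_mulrn.
have [s sv sP] := vring_finite_mod c fin.
have digit_sum (d : nat -> L) : (forall m, d m \in s) ->
    exists y, forall N, vge v (N * c)%N (\sum_(m < N) p%:R ^+ m * d m - y).
  (* [A b N] collects the powers of p whose digit is [b]; it lies in the small field, where it
     converges. *)
  move=> ds; pose A b N : k := \sum_(m < N) p%:R ^+ m *+ (d m == b).
  have /choice[a aP] b : exists a, forall N, vge vk (N * ck)%N (A b N - a).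
    apply: vseries_cvg => // N; rewrite /A big_ord_recr /= addrAC subrr add0r.
    case: (_ == _); last exact: vge0.
    by rewrite vge_neq0 ?expf_neq0 // vkpX.
  exists (\sum_(b <- undup s) iota (a b) * b) => N.
  have -> : \sum_(m < N) p%:R ^+ m * d m = \sum_(b <- undup s) iota (A b N) * b.
    under [RHS]eq_bigr => b _ do rewrite rmorph_sum mulr_suml.
    rewrite exchange_big /=; apply: eq_bigr => m _.
    rewrite (bigD1_seq (d m)) ?mem_undup ?undup_uniq //= eqxx rmorphXn rmorph_nat.
    rewrite big1 ?addr0 // => b /negbTE bd.
    by rewrite eq_sym bd mulr0n rmorph0 mul0r.
  rewrite -sumrB big_seq vge_sum // => b; rewrite mem_undup => bs.
  rewrite -mulrBl -rmorphB vgeMr ?sv //.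
  (* Divisibility by p^N in the ring of [k] is preserved by [iota]. *)
  rewrite -vpX vge_quot ?expf_neq0 // -(rmorph_nat iota) -rmorphXn -fmorph_div.
  by apply: iotaP; rewrite -vge_quot ?expf_neq0 // vkpX.
have /choice[pick pickP] x : exists b, x \in vring v -> b \in s /\ vge v c (x - b).
  have [/sP[b]|_] := boolP (x \in vring v); last by exists 0.
  by exists b.
(* Subtracting a far term makes the sequence integral. *)
have [N0 uN0] := u_cauchy 0; pose w i := u (N0 + i)%N - u N0.
have vw i : w i \in vring v by apply: uN0; rewrite ?leq_addr.
have /choice[y yP] N : exists y, y \in vring v /\
    exists M, forall i, (M <= i)%N -> vge v (N * c)%N (w i - y).
  have [M uM] := u_cauchy (N * c)%N; exists (w M); split=> //; exists M => i Mi.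
  by rewrite /w opprB addrA subrK; apply: uM; rewrite ?leq_addl // (leq_trans Mi) ?leq_addl.
have y_diff N : vge v (N * c)%N (y N.+1 - y N).
  have [_ [M yM]] := yP N; have [_ [M' yM']] := yP N.+1.
  apply: vge_trans (yM (M + M')%N (leq_addr _ _)); rewrite vgeBC.
  by apply: vge_le (yM' _ (leq_addl _ _)); rewrite lez_nat leq_mul2r leqnSn orbT.
(* Greedy expansion: [S N] has N digits and agrees with [y N] modulo p^N. The next quotient is
   integral because [y N.+1] and [y N] agree modulo p^N. *)
pose S := fix S N : L := if N is N'.+1 then
  S N' + p%:R ^+ N' * pick ((y N'.+1 - S N') / p%:R ^+ N') else 0.
have S_y N : vge v (N * c)%N (y N - S N).
  elim: N => [|N IHN] /=; first by rewrite subr0; have [] := yP 0.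
  have vyS : vge v (N * c)%N (y N.+1 - S N) by apply: vge_trans IHN.
  have vq : (y N.+1 - S N) / p%:R ^+ N \in vring v.
    by rewrite -vge_quot ?expf_neq0 ?vpX.
  have [_ vqb] := pickP _ vq.
  set b := pick _ in vqb *.
  have -> : y N.+1 - (S N + p%:R ^+ N * b) =
      p%:R ^+ N * ((y N.+1 - S N) / p%:R ^+ N - b).
    by rewrite mulrBr [_ * (_ / _)]mulrC divfK ?expf_neq0 // opprD addrA.
  by rewrite mulSn addnC PoszD -vpX vge_mul2l ?expf_neq0.
pose d N := pick ((y N.+1 - S N) / p%:R ^+ N).
have S_sum N : S N = \sum_(m < N) p%:R ^+ m * d m.
  by elim: N => [|N IHN]; rewrite ?big_ord0 // big_ord_recr /= -IHN.
have ds N : d N \in s.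
  apply: (pickP _ _).1; rewrite -vge_quot ?expf_neq0 // vpX.
  by apply: vge_trans (S_y N).
have [l lP] := digit_sum d ds.
exists (l + u N0) => n; have n_le : n <= (`|n|%N * c)%N by nia.
have [_ [M yM]] := yP `|n|%N; exists (N0 + M)%N => i Mi; apply: vge_le n_le _.
have N0i := leq_trans (leq_addr M N0) Mi.
have := yM (i - N0)%N; rewrite leq_subRL // Mi => /(_ isT).
rewrite /w subnKC // => wy.
rewrite opprD addrCA addrC -addrA [- u N0 - l]addrC [- l - _]addrC addrA.
by apply: vge_trans wy _; apply: vge_trans (S_y _) _; rewrite S_sum.
Qed.

End CompleteExtension.

(** * Levels of p-th powers of units *)

Section PthPowers.
Variables (p : nat) (p_pr : prime p) (L : fieldType) (v : dvaluation p L).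

(** The middle binomial coefficients are divisible by p. The term of degree 1 is kept apart, so that
    the remaining error is a multiple of p z^2. *)
Lemma exprD1p z : z \in vring v ->
  exists2 w, w \in vring v & (1 + z) ^+ p = 1 + z ^+ p + p%:R * z * (1 + z * w).
Proof.
move=> vz; have p_gt1 := prime_gt1 p_pr.
have [n pE] : exists n, p = n.+2 by exists p.-2; lia.
pose w := \sum_(i < n) z ^+ i *+ ('C(p, i.+2) %/ p).
have wE : \sum_(i < n) z ^+ i.+2 *+ 'C(p, i.+2) = p%:R * z * (z * w).
  rewrite !mulr_sumr; apply: eq_bigr => i _.
  have /dvdnP[d ->] : (p %| 'C(p, i.+2))%N by rewrite prime_dvd_bin // pE !ltnS /=.
  rewrite mulnK ?prime_gt0 // -[in LHS]mulr_natl -[in RHS]mulr_natl natrM !exprS.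
  by ring.
exists w; first by apply: rpred_sum => i _; rewrite rpredMn ?rpredX.
have split_sum m (f : nat -> L) : m = n.+2 ->
    \sum_(i < m.+1) f i = f 0 + (f 1%N + (\sum_(i < n) f i.+2 + f m)).
  by move=> ->; rewrite big_ord_recl big_ord_recl big_ord_recr.
rewrite exprDn.
under eq_bigr => i _ do rewrite expr1n mul1r.
rewrite (split_sum _ (fun i => z ^+ i *+ 'C(p, i))) // wE binn bin0 bin1 !mulr1n.
by rewrite expr1 expr0 -mulr_natl; ring.
Qed.


Lemma vge_powp k z : vge v (p * k)%N (z ^+ p) -> vge v k z.
Proof.
have [->|z0] := eqVneq z 0; first by rewrite vge0.
have p_gt0 := prime_gt0 p_pr; rewrite !vge_neq0 ?expf_neq0 // dvalX //.
rewrite -mulr_natl natz PoszM ler_pM2l //; lia.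
Qed.

Lemma vge1_powp z : vge v 1 (z ^+ p) -> vge v 1 z.
Proof.
have [->|z0] := eqVneq z 0; first by rewrite vge0.
have p_gt0 := prime_gt0 p_pr; rewrite !vge_neq0 ?expf_neq0 // dvalX //.
rewrite -mulr_natl natz; nia.
Qed.

Lemma vge1_p : vge v 1 p%:R.
Proof. by rewrite /vge; have := dval_p v; case: (_ == 0). Qed.

(** The cofactor of x - y in x^p - y^p reduces to p y^(p-1) = 0, which gains one level. *)
Lemma pth_power_congr n x y : x \in vring v -> y \in vring v -> 0 < n ->
  vge v n (x - y) -> vge v (n + 1) (x ^+ p - y ^+ p).
Proof.
move=> vx vy n_gt0 vxy; rewrite subrXX; apply: vgeM => //.
have /eqP red_xy : red v x == red v y by rewrite red_eq //; apply: vge_le vxy; lia.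
rewrite -vge_red0 ?rpred_sum // => [|i _]; last by rewrite rpredM ?rpredX.
rewrite red_sum => [|i]; last by rewrite rpredM ?rpredX.
apply/eqP; under eq_bigr => i _ do
  rewrite redM ?rpredX // !redX // red_xy -exprD subnK -1?ltnS ?prednK ?prime_gt0 //.
by rewrite sumr_const card_ord (mulrn_pchar (residue_pchar v p_pr)).
Qed.

Lemma residue_natr_eq0 n : (n%:R == 0 :> residue v) = (p %| n)%N.
Proof. by rewrite -(dvdn_pcharf (residue_pchar v p_pr)). Qed.

(** The cofactor of x - 1 in x^e - 1 reduces to e, which is nonzero in characteristic p. *)
Lemma unity_root_vge1 e x : coprime p e -> x ^+ e = 1 -> vge v 1 (x - 1) -> x = 1.
Proof.
move=> pe xe vx; have vx0 : x \in vring v.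
  by rewrite -[x](subrK 1) rpredD ?rpred1 // (vge_vring _ vx).
have red_x : red v x = 1.
  by rewrite -red1; apply/eqP; rewrite red_eq ?rpred1.
have := subrX1 x e; rewrite xe subrr => /esym/eqP; rewrite mulf_eq0 subr_eq0.
case/orP=> [/eqP//|/eqP sum0].
have : red v (\sum_(i < e) x ^+ i) = e%:R.
  elim: {pe xe sum0}e => [|e IHe]; first by rewrite big_ord0 red0.
  rewrite big_ord_recr redD ?rpred_sum ?rpredX // => [|i _]; last exact: rpredX.
  by rewrite IHe redX // red_x expr1n -natr1.
rewrite sum0 red0 => /esym/eqP; rewrite residue_natr_eq0 => /coprime_dvdr/(_ pe).
by rewrite /coprime gcdnn; have := prime_gt1 p_pr; case: p => [|[]].
Qed.

(** A finite field is perfect: its Frobenius is injective, hence surjective. *)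
Lemma res_pth_root a : finite_set [set: residue v] -> a \in vring v ->
  exists2 c, c \in vring v & vge v 1 (a - c ^+ p).
Proof.
move=> fin va; pose k : finFieldType := finresidue fin.
have pk : p \in [pchar k] by exact: residue_pchar v p_pr.
have /injF_bij[g _ gK] : injective (pFrobenius_aut pk) by exact: fmorph_inj.
have [c vc cE] := red_surj (g (red v a) : residue v); exists c => //.
rewrite -vmaxE -red_eq ?rpredX // redX // -cE.
by rewrite -[X in X == _](gK (red v a)).
Qed.

End PthPowers.

(** For z of level j, z^p has level p j and p z has level (p-1) r + j. The two cross at j = r, which
    singles out the level p r. *)
Lemma level_lt p r j : prime p -> (j < r)%N -> (p * j < p.-1 * r + j)%N.
Proof.
move=> p_pr jr; have [n pE] : exists n, p = n.+2.
  by exists p.-2; have := prime_gt1 p_pr; lia.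
by rewrite {1 2}pE /= mulSnr ltn_add2r ltn_pmul2l.
Qed.

Lemma level_ge p r j : prime p -> (r <= j)%N -> (p * r <= p.-1 * r + j)%N.
Proof. by move=> p_pr rj; rewrite -{1}(prednK (prime_gt0 p_pr)) mulSnr leq_add2l. Qed.

Section PthPowerLevels.
Variables (p : nat) (p_pr : prime p) (L : fieldType) (v : dvaluation p L).
Variable r : nat.
Hypotheses (pL0 : p%:R != 0 :> L) (r_gt0 : (0 < r)%N) (vp : v p%:R = (p.-1 * r)%N).

Lemma I_boundE : I_bound v = (p * r)%N.
Proof.
rewrite /I_bound /absolute_ramification_index vp /= mulnCA mulKn //.
by have := prime_gt1 p_pr; lia.
Qed.

Lemma pow1D_mod (k : nat) z : vge v k z ->
  vge v (p.-1 * r + k)%N ((1 + z) ^+ p - (1 + z ^+ p)).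
Proof.
move=> vz; have vz0 : z \in vring v by apply: vge_vring vz.
have [w vw ->] := exprD1p p_pr vz0.
rewrite addrAC subrr add0r vgeMr //; first by rewrite rpredD ?rpred1 ?rpredM.
by rewrite PoszD -vp; apply: vgeM; rewrite // vge_neq0.
Qed.

(** By perfectness the coefficient of x - 1 at level p j is a p-th power c^p. For z = c w^j the
    power (1 + z)^p matches x there, since p z lies deeper when j < r. *)
Lemma fil_pth_power j x : finite_set [set: residue v] -> (0 < j < r)%N ->
  vge v (p * j)%N (x - 1) ->
  exists y, [/\ y != 0, v y = 0 & vge v (p * j).+1 (x - y ^+ p)].
Proof.
move=> fin /andP[j_gt0 jr] vx; have p_gt1 := prime_gt1 p_pr.
have [w /andP[w0 /eqP vw]] := dval_surj v.
have vwX n : v (w ^+ n) = n by rewrite dvalX // vw natz.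
have va : (x - 1) / w ^+ (p * j) \in vring v by rewrite -vge_quot ?expf_neq0 // vwX.
have [c vc cP] := res_pth_root p_pr fin va.
have vz : vge v j (c * w ^+ j) by rewrite vgeMl // vge_neq0 ?expf_neq0 // vwX.
have [y0 vy] : 1 + c * w ^+ j != 0 /\ v (1 + c * w ^+ j) = 0.
  by apply: vring1D_unit; apply: vge_le vz; lia.
exists (1 + c * w ^+ j); split=> //.
rewrite -[x](subrK (1 + (c * w ^+ j) ^+ p)) -addrA; apply: vgeD.
  rewrite opprD addrA exprMn -exprM [(j * p)%N]mulnC.
  rewrite -[x - 1](divfK (expf_neq0 (p * j) w0)) -mulrBl mulrC -addn1 PoszD -{1}[(p * j)%:Z]vwX.
  by rewrite vge_mul2l ?expf_neq0.
rewrite vgeBC; apply: vge_le (pow1D_mod vz); exact: level_lt.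
Qed.

(** In the residue field y^p - 1 = (y - 1)^p. *)
Lemma vring1_pth_root y : y != 0 -> vge v 1 (y ^+ p - 1) -> vge v 1 (y - 1).
Proof.
move=> y0 vyp.
have vy : y \in vring v.
  rewrite vringE vge_powp // muln0.
  by rewrite -[y ^+ p](subrK 1) vgeD ?(vge_le _ vyp) //; exact: (rpred1 (vring v)).
apply: (vge1_powp p_pr).
rewrite -vmaxE -red_eq ?rpredX ?rpred1 // in vyp.
have pk := residue_pchar v p_pr.
rewrite -vge_red0 ?rpredX ?rpredB ?rpred1 // redX ?rpredB ?rpred1 //.
rewrite redD ?rpredN ?rpred1 // redN ?rpred1 // red1.
rewrite -(pFrobenius_autE pk) pFrobenius_autB_comm ?pFrobenius_aut1; last exact: mulrC.
by rewrite pFrobenius_autE -redX // subr_eq0 -red1.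
Qed.

(* For [1 + z] of level [k = v z < r] the p-th power has level exactly [p k]. *)
Lemma pth_power_level z k n : vge v 1 z -> z != 0 -> v z = Posz k -> (k < r)%N ->
  vge v n ((1 + z) ^+ p - 1) -> n <= (p * k)%N.
Proof.
move=> vz z0 vzk kr vyn; have p_gt1 := prime_gt1 p_pr; rewrite leNgt; apply/negP => n_gt.
have vzk' : vge v k z by rewrite vge_neq0 // vzk.
have := pow1D_mod vzk'; rewrite opprD addrA => v_pow.
have vzp : v (z ^+ p) = (p * k)%N by rewrite dvalX // vzk posz_mulrn.
suff : vge v (v (z ^+ p) + 1) (z ^+ p) by apply/negP; rewrite vgeNS // expf_neq0.
rewrite vzp.
rewrite -[z ^+ p](subKr ((1 + z) ^+ p - 1)); apply: vgeB.
  by apply: vge_le vyn; lia.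
by apply: vge_le v_pow; have := level_lt p_pr kr; lia.
Qed.

(** Write y = 1 + z with z nonzero of level k. If k < r then y^p - 1 has level p k, which is not j;
    if k >= r its level is at least p r > j. *)
Lemma pth_power_gap j y : y != 0 -> (0 < j < p * r)%N -> ~~ (p %| j)%N ->
  vge v j (y ^+ p - 1) -> vge v j.+1 (y ^+ p - 1).
Proof.
move=> y0 /andP[j_gt0 jI] pj vy; have p_gt1 := prime_gt1 p_pr.
have vz : vge v 1 (y - 1) by apply: vring1_pth_root y0 (vge_le _ vy).
have [z0|z0] := eqVneq (y - 1) 0.
  by rewrite (subr0_eq z0) expr1n subrr vge0.
have [k vk] : exists k : nat, v (y - 1) = k.
  by move: vz; rewrite vge_neq0 //; exists (absz (v (y - 1))); lia.
have yE : y = 1 + (y - 1) by rewrite addrC subrK.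
have vzk : vge v k (y - 1) by rewrite vge_neq0 // vk.
have := pow1D_mod vzk; rewrite -yE opprD addrA => v_pow.
have vzp : vge v (p * k)%N ((y - 1) ^+ p) by have := vgeX p vzk; rewrite posz_mulrn.
rewrite -[y ^+ p - 1](subrK ((y - 1) ^+ p)).
have [kr|rk] := ltnP k r; last first.
  apply: vgeD; [apply: vge_le v_pow | apply: vge_le vzp]; rewrite lez_nat.
    exact: leq_trans (level_ge p_pr rk).
  by rewrite (leq_trans jI) // leq_mul2l rk orbT.
have jk : (j < p * k)%N.
  rewrite ltn_neqAle; apply/andP; split.
    by apply: contraNneq pj => ->; rewrite dvdn_mulr.
  by rewrite -lez_nat; apply: (pth_power_level vz z0 vk) => //; rewrite -yE.
apply: vgeD; [apply: vge_le v_pow | apply: vge_le vzp]; rewrite lez_nat //.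
exact: leq_trans (ltnW (level_lt p_pr kr)).
Qed.

(** Newton iteration in multiplicative form. Beyond level p r = v(p) + r, dividing by p leaves z of
    level above r, and then the new errors z^p and p z^2 both lie deeper than the old one. *)
Lemma pth_root_cvg x : vcomplete v -> vge v (p * r).+1 (x - 1) ->
  exists y, x = y ^+ p.
Proof.
move=> v_complete vx; have p_gt1 := prime_gt1 p_pr.
have [x0 vx_unit] : x != 0 /\ v x = 0.
  by rewrite -[x](subrK 1) addrC; apply: vring1D_unit; apply: vge_le vx; lia.
pose step y : L := y * (1 + (x / y ^+ p - 1) / p%:R).
pose u n := iter n step 1.
have uP n : [/\ u n != 0, v (u n) = 0, vge v ((p * r).+1 + n)%N (x / u n ^+ p - 1) &
    vge v n (u n.+1 - u n)].
  have ind y (m : nat) : y != 0 -> v y = 0 ->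
      vge v ((p * r).+1 + m)%N (x / y ^+ p - 1) ->
      [/\ step y != 0, v (step y) = 0,
        vge v ((p * r).+1 + m).+1%N (x / step y ^+ p - 1) & vge v m (step y - y)].
    move=> y0 vy vxy; set z := (x / y ^+ p - 1) / p%:R.
    have vz : vge v (r + m.+1)%N z.
      rewrite -(vge_div _ _ _) // vp; apply: vge_le vxy; rewrite -PoszD lez_nat; nia.
    have [z0 vz0] : 1 + z != 0 /\ v (1 + z) = 0.
      by apply: vring1D_unit; apply: vge_le vz; lia.
    rewrite /step -/z; split; rewrite ?mulf_neq0 //.
    - by rewrite dvalM // vy vz0.
    - have -> : x / (y * (1 + z)) ^+ p - 1 =
          ((x / y ^+ p) - (1 + z) ^+ p) / (1 + z) ^+ p.
        by rewrite exprMn invfM mulrA mulrBl divff // expf_neq0.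
      have vzp : v ((1 + z) ^+ p) = 0 by rewrite dvalX // vz0 mul0rn.
      rewrite -vge_div ?expf_neq0 // vzp add0r.
      have vz_ring : z \in vring v by apply: vge_vring vz.
      have [w vw ->] := exprD1p p_pr vz_ring.
      have -> : x / y ^+ p = 1 + p%:R * z by rewrite [p%:R * z]mulrC divfK // addrC subrK.
      have -> : 1 + p%:R * z - (1 + z ^+ p + p%:R * z * (1 + z * w)) =
          - (z ^+ p + p%:R * (z * z) * w) by ring.
      apply/vgeN/vgeD.
        apply: vge_le (vgeX p vz).
        rewrite posz_mulrn lez_nat mulnDr addSn -addnS -addnS leq_add2l.
        apply: leq_trans (leq_mul p_gt1 (leqnn m.+1)).
        by rewrite mul2n -addnn addSn ltnS leq_addl.
      rewrite vgeMr //.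
      apply: vge_le (vgeM (_ : vge v (v p%:R) p%:R) (vgeM vz vz)).
        rewrite vp -!PoszD lez_nat addSnnS -addn1 addnA leq_add ?addn_gt0 ?r_gt0 //.
        by rewrite addnA leq_add2r level_ge.
      by rewrite vge_neq0.
    rewrite mulrDr mulr1 addrAC subrr add0r vgeMl ?unit_vring //.
    by apply: vge_le vz; lia.
  elim: n => [|n [un0 vun vxn _]].
    have v1 : vge v ((p * r).+1 + 0)%N (x / 1 ^+ p - 1) by rewrite expr1n divr1 addn0.
    by have [] := ind 1 0 (oner_neq0 _) (dval1 v) v1; rewrite oner_neq0 dval1.
  have [u1 vu1 vxu _] := ind _ _ un0 vun vxn.
  by rewrite -addnS in vxu; have [_ _ _ vu2] := ind _ _ u1 vu1 vxu; split.
have [|y yP] := vseries_cvg v_complete (isT : (0 < 1)%N) (u := u).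
  by move=> n; rewrite muln1; have [] := uP n.
exists y; apply/eqP; rewrite -subr_eq0; apply/eqP; apply: (@vge_all0 _ _ v) => n.
have [un0 vun vxn _] := uP n.
have vy : y \in vring v.
  rewrite -[y](subrK (u 0)) rpredD ?rpred1 // vringE vgeBC.
  by have := yP 0%N.
apply: (@vge_trans _ _ _ _ _ (u n ^+ p)).
  have -> : x - u n ^+ p = u n ^+ p * (x / u n ^+ p - 1).
    by rewrite mulrBr mulr1 mulrC divfK // expf_neq0.
  by rewrite vgeMl ?rpredX ?unit_vring //; apply: vge_le vxn; lia.
rewrite subrXX; apply: vgeMr; last by have := yP n; rewrite muln1.
by have vu := unit_vring vun; apply: rpred_sum => i _; rewrite rpredM ?rpredX.
Qed.

End PthPowerLevels.

(** * The element lam = zp - 1 and the critical level p r *)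

Section KummerFiltration.
Variables (p : nat) (p_pr : prime p) (L : fieldType) (v : dvaluation p L).
Variables (zp : L) (zpP : p.-primitive_root zp).
Hypothesis pL0 : p%:R != 0 :> L.
Local Notation lam := (zp - 1).

Lemma lam_neq0 : lam != 0.
Proof.
rewrite subr_eq0; apply/eqP => zp1; have := prim_order_dvd zpP 1.
by rewrite zp1 expr1n eqxx; have := prime_gt1 p_pr; case: p => [|[]].
Qed.

Lemma lam_vring : lam \in vring v.
Proof.
rewrite rpredB ?rpred1 // unit_vring //.
have zp0 : zp != 0.
  apply/eqP => z0; have /eqP := prim_expr_order zpP.
  by rewrite z0 expr0n gtn_eqF ?prime_gt0 // eq_sym oner_eq0.
have := dvalX v p zp0; rewrite (prim_expr_order zpP) dval1 => /esym/eqP.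
by rewrite mulrn_eq0 gtn_eqF ?prime_gt0 // => /eqP.
Qed.

(** Expand 1 = (1 + lam)^p and solve for lam^p. *)
Lemma lam_powp : exists2 w, w \in vring v & lam ^+ p = - (p%:R * lam * (1 + lam * w)).
Proof.
have [w vw] := exprD1p p_pr lam_vring; rewrite addrC subrK (prim_expr_order zpP).
move/eqP; rewrite -addrA -subr_eq0 opprD addrA subrr sub0r oppr_eq0 addr_eq0.
by move/eqP; exists w.
Qed.

(** Valuations in [lam_powp] give p v(lam) = v(p) + v(lam). Positivity of v(lam) comes first, from p
    dividing lam^p; it makes the last factor a unit. *)
Lemma dval_lam : exists2 r : nat, (0 < r)%N & v lam = r /\ v p%:R = (p.-1 * r)%N.
Proof.
have [w vw lamE] := lam_powp; have lam0 := lam_neq0.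
have v1lam : vge v 1 lam.
  apply: (vge1_powp p_pr); rewrite lamE; apply/vgeN; rewrite vgeMr ?vgeMr ?lam_vring //.
    by rewrite rpredD ?rpred1 // rpredM ?lam_vring.
  exact: vge1_p.
have [u0 vu] : 1 + lam * w != 0 /\ v (1 + lam * w) = 0.
  by apply: vring1D_unit; rewrite vgeMr.
have := congr1 v lamE; rewrite dvalN !dvalM ?mulf_neq0 // vu addr0 dvalX //.
move: v1lam; rewrite vge_neq0 // -[v lam *+ p]mulr_natl natz => vlam vE.
exists `|v lam|%N; first lia.
have := prime_gt0 p_pr; move: vlam vE; case: (v lam) => // r _ vE p_gt0.
split=> //; have pE : (p * r = p.-1 * r + r)%N by rewrite -mulSnr prednK.
by apply: (addIr r%:Z); rewrite -PoszD -pE PoszM.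
Qed.

Variable r : nat.
Hypotheses (r_gt0 : (0 < r)%N) (vlam : v lam = r) (vp : v p%:R = (p.-1 * r)%N).

(** For z = lam c both z^p and p z reach level p r, and p lam agrees with -lam^p to leading order,
    so together they give the Artin-Schreier expression. *)
Lemma pow1_lam_mod c : c \in vring v ->
  vge v (p * r).+1 ((1 + lam * c) ^+ p - (1 + lam ^+ p * (c ^+ p - c))).
Proof.
move=> vc; have p_gt1 := prime_gt1 p_pr; have [w0 vw0 lamE] := lam_powp.
have [w vw ->] := exprD1p p_pr (rpredM lam_vring vc).
have -> : 1 + (lam * c) ^+ p + p%:R * (lam * c) * (1 + lam * c * w) -
    (1 + lam ^+ p * (c ^+ p - c)) = p%:R * (lam * lam) * (c * c * w - w0 * c).
  by rewrite exprMn mulrBr lamE; ring.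
rewrite vgeMr ?rpredB ?rpredM //.
by rewrite vge_neq0 ?mulf_neq0 ?lam_neq0 // !dvalM ?mulf_neq0 ?lam_neq0 // vlam vp; nia.
Qed.

(** By [pth_power_level] a p-th power at level p r forces y - 1 to have level at least r; so y = 1 +
    lam c, and [pow1_lam_mod] compares coefficients. *)
Lemma top_pth_power b y : b \in vring v -> y != 0 ->
  vge v (p * r).+1 (y ^+ p - (1 + lam ^+ p * b)) ->
  exists2 c, c \in vring v & vge v 1 (b - (c ^+ p - c)).
Proof.
move=> vb y0 vy; have p_gt1 := prime_gt1 p_pr.
have v_lamp : v (lam ^+ p) = (p * r)%N by rewrite dvalX ?lam_neq0 // vlam posz_mulrn.
have vyI : vge v (p * r)%N (y ^+ p - 1).
  rewrite -[y ^+ p - 1](subrK (lam ^+ p * b)); apply: vgeD.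
    by rewrite -addrA -opprD; apply: vge_le vy; lia.
  by rewrite vgeMr // -v_lamp vge_neq0 ?expf_neq0 ?lam_neq0.
have vz : vge v 1 (y - 1) by apply: vring1_pth_root y0 (vge_le _ vyI); nia.
have yE : y = 1 + (y - 1) by rewrite addrC subrK.
have vzr : vge v r (y - 1).
  have [->|z0] := eqVneq (y - 1) 0; first exact: vge0.
  have [k vk] : exists k : nat, v (y - 1) = k.
    by move: vz; rewrite vge_neq0 //; exists (absz (v (y - 1))); lia.
  rewrite vge_neq0 // vk lez_nat leqNgt; apply/negP => kr.
  have := pth_power_level p_pr pL0 r_gt0 vp vz z0 vk kr; rewrite -yE => /(_ _ vyI).
  by rewrite lez_nat leq_pmul2l ?prime_gt0 // leqNgt kr.
have vc : (y - 1) / lam \in vring v by rewrite -vge_quot ?lam_neq0 // vlam.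
exists ((y - 1) / lam) => //; have := pow1_lam_mod vc.
rewrite [lam * _]mulrC divfK ?lam_neq0 // -yE => v_pow.
rewrite -(vge_mul2l v _ _ (expf_neq0 p lam_neq0)) v_lamp -PoszD addn1.
set X := _ ^+ p - _ / _ in v_pow *.
have -> : lam ^+ p * (b - X) =
  y ^+ p - (1 + lam ^+ p * X) - (y ^+ p - (1 + lam ^+ p * b)) by ring.
exact: vgeB.
Qed.

End KummerFiltration.

(** * The Artin-Schreier map on a finite field *)

Lemma pth_power_subD (R : comNzRingType) (p : nat) (pR : p \in [pchar R]) (x y : R) :
  (x + y) ^+ p - (x + y) = (x ^+ p - x) + (y ^+ p - y).
Proof.
rewrite -!(pFrobenius_autE pR) pFrobenius_autD_comm; last exact: mulrC.
by ring.
Qed.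

(** Telescoping sum, with c the sum of the b^(p^i) for i < j. Powers of Frobenius thus act trivially
    modulo the Artin-Schreier image. *)
Lemma iter_pth_power_sub (R : comNzRingType) (p : nat) (pR : p \in [pchar R])
    (b : R) (j : nat) : exists c : R, b ^+ (p ^ j) - b = c ^+ p - c.
Proof.
have p_gt0 : (0 < p)%N by apply/prime_gt0/(pcharf_prime pR).
elim: j => [|j [c cE]].
  by exists 0; rewrite expn0 expr1 subrr expr0n gtn_eqF // subr0.
exists (b ^+ (p ^ j) + c); rewrite pth_power_subD // -cE -exprM -expnSr.
by ring.
Qed.

Section ArtinSchreier.
Variables (p : nat) (k : finFieldType) (pk : p \in [pchar k]).
Local Notation R := (pPrimeCharType pk).

Definition artin_schreier (x : R) : R := x ^+ p - x.

Lemma artin_schreier_linear : linear artin_schreier.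
Proof.
have p_pr := pcharf_prime pk.
move=> a x y; rewrite /artin_schreier pth_power_subD //; congr (_ + _).
by have := expf_card a; rewrite card_Fp // exprZn => ->; rewrite scalerBr.
Qed.
HB.instance Definition _ :=
  GRing.isLinear.Build 'F_p R R *:%R artin_schreier artin_schreier_linear.

Lemma artin_schreier_ker : lker (linfun artin_schreier) = 1%VS.
Proof.
have p_pr := pcharf_prime pk.
apply/vspaceP => x; rewrite memv_ker lfunE /= subr_eq0.
have := Fermat's_little_theorem (1%AS : {subfield R}) x.
by rewrite dimv1 expn1 card_Fp.
Qed.

(** The kernel is the prime field, so the image is a hyperplane, and any [b0] outside it spans a
    complementary line. *)
Lemma artin_schreier_coker : exists b0 : k,
  (forall b : k, exists m, exists c : k, b = b0 *+ m + (c ^+ p - c)) /\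
  (forall m (c : k), b0 *+ m = c ^+ p - c -> (p %| m)%N).
Proof.
have p_pr := pcharf_prime pk.
set f := linfun artin_schreier.
have dim_f : (\dim (limg f)).+1 = \dim {: R}.
  by rewrite -(limg_ker_dim f fullv) capfv artin_schreier_ker dimv1 add1n.
have [b0 b0P] : exists b0 : R, b0 \notin limg f.
  apply: contrapT => nob; suff : (fullv <= limg f)%VS by move/dimvS; rewrite -dim_f ltnn.
  apply/subvP => b _; apply/negPn/negP => bP; apply: nob; by exists b.
have b00 : b0 != 0 by apply: contraNneq b0P => ->; rewrite mem0v.
have b0_cap (a : 'F_p) : a *: b0 \in limg f -> a = 0.
  move=> ab; apply/eqP/negPn/negP => a0; case/negP: b0P.
  by rewrite -[b0]scale1r -(mulVf a0) -scalerA memvZ.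
have full : (<[b0]> + limg f)%VS = fullv.
  apply/eqP; rewrite eqEdim subvf -dim_f dimv_disjoint_sum ?dim_vline ?b00 //.
    by apply/eqP; rewrite add1n subnn.
  apply/eqP; rewrite -subv0; apply/subvP => x; rewrite memv_cap.
  by case/andP=> /vlineP[a ->] /b0_cap->; rewrite scale0r mem0v.
exists b0; split=> [b|m c b0m].
  have : (b : R) \in (<[b0]> + limg f)%VS by rewrite full memvf.
  case/memv_addP => _ /vlineP[a ->] [_ /memv_imgP[c _ ->] ->].
  by exists a, c; rewrite lfunE -mulr_natl.
have : (m%:R : 'F_p) = 0.
  apply: b0_cap; rewrite scaler_nat b0m.
  by have := memv_img f (memvf (c : R)); rewrite lfunE.
by move/eqP; rewrite -(dvdn_pcharf (pchar_Fp p_pr)).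
Qed.

End ArtinSchreier.

(** * Independence of characters and cardinality of residue fields *)

Lemma dedekind_independence (k : idomainType) (n : nat) (f : nat -> k -> k) (a : nat -> k) :
    (forall i, f i 1 = 1) -> (forall i x y, f i (x * y) = f i x * f i y) ->
    (forall i j, (i < j < n)%N -> exists x, f i x != f j x) ->
    (forall x, \sum_(i < n) a i * f i x = 0) ->
  forall i, (i < n)%N -> a i = 0.
Proof.
move=> f1 fM; elim: n a => // n IHn a f_neq sum0.
have a_lt i : (i < n)%N -> a i = 0.
  move=> i_n; have [|y fy] := f_neq i n; first by rewrite i_n ltnSn.
  suff : a i * (f i y - f n y) = 0.
    by move/eqP; rewrite mulf_eq0 subr_eq0 (negbTE fy) orbF => /eqP.
  apply: (IHn (fun i => a i * (f i y - f n y))) i_n => [j l /andP[jl ln]|x].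
    by apply: f_neq; rewrite jl ltnW.
  (* Subtracting [f n y] times the relation at x from the relation at y x removes the last
     character. *)
  have := sum0 (y * x); rewrite big_ord_recr /= => sum_yx.
  have := congr1 ( *%R (f n y)) (sum0 x); rewrite mulr0 big_ord_recr /= => sum_x.
  have := congr2 (fun u w => u - w) sum_yx sum_x.
  rewrite subr0 /= => sum_diff; rewrite -[RHS]sum_diff.
  rewrite fM mulrDr opprD addrACA [a n * _]mulrCA subrr addr0 mulr_sumr -sumrB.
  by apply: eq_bigr => j _; rewrite fM; ring.
move=> i; rewrite ltnS leq_eqVlt => /orP[/eqP->|/a_lt//].
have := sum0 1; rewrite big_ord_recr /= big1 ?add0r ?f1 ?mulr1 // => j _.
by rewrite a_lt ?mul0r.
Qed.

Lemma finite_roots (k : fieldType) (P : {poly k}) : P != 0 ->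
  (forall x : k, root P x) -> finite_set [set: k].
Proof.
move=> P0 P_root; apply: contrapT => inf; have [B _] := infinite_set_fset (size P) inf.
apply/negP; rewrite -ltnNge; apply: max_poly_roots => //; last exact: fset_uniq.
by apply/allP.
Qed.

Lemma card_residue_pow (p : nat) (p_pr : prime p) (L : fieldType) (v : dvaluation p L) :
  finite_set [set: residue v] -> exists2 b, (0 < b)%N & residue_card v = (p ^ b)%N.
Proof.
move=> fin; have pk : p \in [pchar finresidue fin] by exact: residue_pchar v p_pr.
have cardE := card_pprimeChar pk; exists (logn p #|{: finresidue fin}|).
  rewrite lt0n; apply/eqP => b0; move: cardE; rewrite b0 expn0.
  have := finRing_gt1 (finresidue fin).
  by move=> gt1 E; move: gt1; rewrite [X in (1 < X)%N]E.
by rewrite -card_finresidue; exact: cardE.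
Qed.

(** * The action of H on the residue field, and an element of trace one *)

Section GaloisAction.
Variables (p : nat) (p_pr : prime p) (K : fieldType) (F : splittingFieldType K).
Variables (vK : dvaluation p K) (vF : dvaluation p F) (S : splitting vK vF).
Local Notation gT := (gal_of {:F}).
Local Notation H := 'Gal({:F} / 1)%G.
Local Notation t := (tau S).
Local Notation u := (ups S).
Local Notation pi := (unif S).
Local Notation q := (residue_card vK).
Local Notation e := (ramification_index vK vF).
Local Notation kF := (residue_space vF p_pr).

(** Were the residue field infinite, [residue_card] would take its default value 0, and the
    Frobenius congruence at x = 0 would put 0 - 0^0 = -1 in the maximal ideal. *)
Lemma residueK_finite : finite_set [set: residue vK].
Proof.
apply: contrapT => inf; have := ups_frobenius S (rpred0 (vring vF)).
have -> : q = 0%N by rewrite /residue_card /fset_set; case: pselect.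
by rewrite rmorph0 expr0 sub0r vmaxE vge_neq0 ?oppr_eq0 ?oner_neq0 // dvalN1.
Qed.

Lemma iter_M_ups j (x : kF) : iter j (@M_ups p K F vK vF p_pr) x = x ^+ (q ^ j).
Proof.
elim: j => [|j IHj]; first by rewrite expn0 expr1.
by rewrite iterS IHj /M_ups -exprM -expnSr.
Qed.

Lemma red_ups_pow j x : x \in vring vF ->
  red vF ((u ^+ j)%g x) = (red vF x : kF) ^+ (q ^ j).
Proof. by move=> vx; have [_ ->] := ups_vring p_pr S j vx; exact: iter_M_ups. Qed.

(** With n the order of [u], the identity u^n acts on residues as x -> x^(q^n); so every residue is
    a root of X^(q^n) - X, nonzero because q > 1. *)
Lemma residueF_finite : finite_set [set: residue vF].
Proof.
have [b b_gt0 qE] := card_residue_pow p_pr residueK_finite.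
have Q_gt1 : (1 < q ^ #[u]%g)%N.
  by rewrite qE -expnM -{1}(expn0 p) ltn_exp2l ?prime_gt1 // muln_gt0 b_gt0 /=.
apply: (@finite_roots (resfield vF) ('X^(q ^ #[u]%g) - 'X)).
  apply/eqP => P0; have := size_polyXn (resfield vF) (q ^ #[u]%g).
  move/eqP: P0; rewrite subr_eq0 => /eqP ->; rewrite size_polyX.
  by case=> E; rewrite -E in Q_gt1.
move=> x; rewrite rootE !hornerE subr_eq0; have [y vy ->] := red_surj x.
by apply/eqP; have := red_ups_pow #[u]%g vy; rewrite expg_order gal_id.
Qed.

Lemma gal_vring s x : s \in H -> x \in vring vF -> s x \in vring vF.
Proof. by move=> Hs vx; have [] := M_funE p_pr S 0 Hs vx. Qed.

Lemma inertiaP s : reflect (s \in H /\ forall x, x \in vring vF -> s x - x \in vmax vF)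
  (s \in inertia vF).
Proof. by rewrite inE; apply: (iffP andP) => -[? /asboolP]. Qed.

(* Perfectness of the residue field: modulo [pi] every integer is a [p]-th power
   [r ^ p], and raising to the power [p] gains one level of congruence. *)
Lemma inertia_fix_unif s : s \in inertia vF -> s pi = pi -> s = 1%g.
Proof.
move=> /inertiaP[Hs s_in] s_pi.
have /andP[pi0 /eqP vpi] := unif_uniformizer S.
have close n x : x \in vring vF -> vge vF n.+1 (s x - x).
  elim: n x => [|n IHn] x vx; first exact: s_in.
  have [r vr xr] := res_pth_root p_pr residueF_finite vx.
  have vy : (x - r ^+ p) / pi \in vring vF by rewrite -vge_quot // vpi.
  have xE : x = r ^+ p + pi * ((x - r ^+ p) / pi).
    by rewrite mulrC divfK // addrC subrK.
  rewrite {}xE; set y := _ / pi in vy *.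
  rewrite rmorphD rmorphM rmorphXn /= s_pi opprD addrACA -mulrBr.
  apply: vgeD; last first.
    have -> : n.+2%:Z = vF pi + n.+1%:Z by rewrite vpi; lia.
    by rewrite vge_mul2l // IHn.
  have -> : n.+2%:Z = n.+1%:Z + 1 by rewrite -PoszD addn1.
  by apply: pth_power_congr; rewrite ?IHn ?gal_vring.
apply/eqP/gal_eqP => x _; rewrite gal_id.
wlog vx : x / x \in vring vF.
  move=> fixed; have [vx|nvx] := boolP (x \in vring vF); first exact: fixed.
  have /fixed : x^-1 \in vring vF.
    have [x0|x0] := eqVneq x 0; first by rewrite x0 rpred0 in nvx.
    by move: nvx; rewrite !vringE !vge_neq0 ?invr_eq0 // dvalV //; lia.
  by rewrite fmorphV => /invr_inj.
apply/eqP; rewrite -subr_eq0; apply/eqP; apply: (@vge_all0 _ _ vF) => n.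
by apply: vge_le (close n x vx); lia.
Qed.

Hypothesis tame : coprime p e.

Lemma unif_ratio_powe (s : gT) : (s pi / pi) ^+ e = 1.
Proof.
have [w /andP[w0 _] piw] := unif_root S.
rewrite exprMn exprVn -rmorphXn /= piw linearZ /= rmorph1 divff //.
by rewrite -piw expf_neq0 // unif_neq0.
Qed.

(** The order of [t] divides e: the ratio of t^e on [pi] is an e-th root of unity reducing to 1, so
    t^e fixes [pi] and is trivial. *)
Lemma tau_order_coprime : coprime p #[t]%g.
Proof.
have te_in : (t ^+ e)%g \in inertia vF by rewrite -(tau_inertia S) mem_cycle.
suff te1 : (t ^+ e)%g = 1%g by apply: coprime_dvdr tame; rewrite order_dvdn te1.
apply: inertia_fix_unif te_in _.
have pi0 := unif_neq0 S; set s := (t ^+ e)%g.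
suff : s pi / pi = 1 by move/(canRL (divfK pi0)); rewrite mul1r.
apply: (unity_root_vge1 (v := vF) p_pr tame (unif_ratio_powe s)).
rewrite -vmaxE -red_eq ?root_ratio ?rpred1 // zeta_barX /zeta_bar -redX ?root_ratio //.
by rewrite unif_ratio_powe.
Qed.

(** M_0 is the residue field with its natural Galois action, over which M_i is semilinear; averaging
    against a residue of trace one rests on this. *)
Lemma M_funM i s (x y : kF) : s \in H ->
  M_fun S i s (x * y) = M_fun S 0 s x * M_fun S i s y.
Proof.
move=> Hs; have [a va ->] := red_surj x; have [b vb ->] := red_surj y.
have vr := root_ratio S s; have [vsa ->] := M_funE p_pr S 0 Hs va.
have [vsb ->] := M_funE p_pr S i Hs vb.
have -> : (red vF a : kF) * red vF b = red vF (a * b) by rewrite redM.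
rewrite (M_funE p_pr S i Hs (rpredM va vb)).2 expr0 mul1r.
by rewrite -[RHS]redM ?rpredM ?rpredX // rmorphM mulrCA.
Qed.

Lemma M_fun0_1 s : s \in H -> M_fun S 0 s (1 : kF) = 1.
Proof.
move=> Hs; have -> : (1 : kF) = red vF 1 by rewrite red1.
by rewrite (M_funE p_pr S 0 Hs (rpred1 _)).2 expr0 mul1r rmorph1.
Qed.

Lemma ups_tau_H j i : (u ^+ j * t ^+ i)%g \in H.
Proof. by rewrite groupM ?groupX ?ups_H ?tau_H. Qed.

Lemma M_fun0_ups_tau j i (x : kF) : M_fun S 0 (u ^+ j * t ^+ i)%g x = x ^+ (q ^ j).
Proof.
have [a va ->] := red_surj x.
rewrite (M_funE p_pr S 0 (ups_tau_H j i) va).2 expr0 mul1r galM ?memvf //.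
have [vua _] := ups_vring p_pr S j va; have [_ ->] := tau_vring S i vua.
exact: red_ups_pow.
Qed.

Lemma sum_gal (V : nmodType) (f : gT -> V) :
  \sum_(h in H) f h = \sum_(j < #[u]%g) \sum_(i < #[t]%g) f (u ^+ j * t ^+ i)%g.
Proof.
rewrite pair_big /=; pose g (ji : 'I_#[u]%g * 'I_#[t]%g) := (u ^+ ji.1 * t ^+ ji.2)%g.
have HE : H = [set g ji | ji in setT] :> {set gT}.
  apply/setP => h; apply/idP/idP => [/(split_gal S)[[i j] /= ->]|/imsetP[[j i] _ ->]].
    exact: (imset_f g (in_setT (j, i))).
  exact: ups_tau_H.
(* Surjectivity onto H and equality of cardinals give injectivity. *)
have g_inj : {in setT &, injective g}.
  apply/imset_injP; rewrite -HE -(sdprod_card (tau_ups S)).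
  rewrite (eq_card (B := {: 'I_#[u]%g * 'I_#[t]%g})) => [|ji]; last first.
    exact: in_setT.
  rewrite card_prod !card_ord.
  by rewrite /order mulnC.
by rewrite [LHS](eq_bigl _ _ (fun h => congr1 (fun A : {set gT} => h \in A) HE))
  big_imset //=; apply: eq_bigl => ji; exact: in_setT.
Qed.

(** If the two powers agreed everywhere, u^(j-i) would be inertial, but the inertia group <t> meets
    <u> trivially. *)
Lemma ups_pow_neq i j : (i < j < #[u]%g)%N ->
  exists x : kF, x ^+ (q ^ i) != x ^+ (q ^ j).
Proof.
move=> /andP[ij ju]; apply: contrapT => all_eq.
have eq_pow (x : kF) : x ^+ (q ^ i) = x ^+ (q ^ j).
  by apply/eqP/negPn/negP => neq; apply: all_eq; exists x.
have u_in : (u ^+ (j - i))%g \in inertia vF.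
  apply/inertiaP; split=> [|x vx]; first by rewrite groupX ?ups_H.
  (* Here y = u^(-i) x, so the claim compares u^j y with u^i y. *)
  have [vy _] := ups_vring p_pr S (#[u]%g - i) vx; set y := (u ^+ _)%g x in vy.
  have xE : x = (u ^+ i)%g y.
    rewrite -galM ?memvf // -expgD subnK ?expg_order ?gal_id //.
    exact: ltnW (ltn_trans ij ju).
  rewrite {1}xE -galM ?memvf // -expgD subnKC ?(ltnW ij) // [X in _ - X]xE.
  have [vi _] := ups_vring p_pr S i vy; have [vj _] := ups_vring p_pr S j vy.
  by rewrite -red_eq // !red_ups_pow // eq_pow.
have [_ _ _ tuI] := sdprodP (tau_ups S).
have : (u ^+ (j - i))%g \in (<[t]> :&: <[u]>)%g.
  by rewrite inE mem_cycle andbT (tau_inertia S).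
rewrite tuI inE -order_dvdn => /dvdn_leq; rewrite subn_gt0 => /(_ ij); lia.
Qed.

(** The trace of c is the order of [t], nonzero by tameness, times the sum of the c^(q^j), nonzero
    for some c by independence. The trace is invariant, so dividing c by it gives trace one. *)
Lemma trace_one : exists c : kF, \sum_(h in H) M_fun S 0 h c = 1.
Proof.
pose k : fieldType := resfield vF.
have [c c_neq0] : exists c : kF, \sum_(j < #[u]%g) c ^+ (q ^ j) != 0.
  apply: contrapT => all0.
  have [] := negP (oner_neq0 k); apply/eqP.
  pose f j (x : k) := x ^+ (q ^ j).
  have f1 j : f j 1 = 1 by rewrite /f expr1n.
  have fM j x y : f j (x * y) = f j x * f j y by rewrite /f exprMn.
  apply: (dedekind_independence f1 fM ups_pow_neq (a := fun=> 1) _ (order_gt0 u)) => x.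
  under eq_bigr do rewrite mul1r.
  by apply/eqP/negPn/negP => neq; apply: all0; exists x.
have nt_neq0 : #[t]%g%:R != 0 :> kF.
  apply/eqP => /eqP; rewrite (residue_natr_eq0 p_pr vF) => /coprime_dvdr/(_ tau_order_coprime).
  by rewrite /coprime gcdnn; have := prime_gt1 p_pr; case: (p) => [|[]].
pose s := \sum_(h in H) M_fun S 0 h c.
have s_neq0 : s != 0.
  rewrite /s sum_gal.
  under eq_bigr => j _ do under eq_bigr => i _ do rewrite M_fun0_ups_tau.
  under eq_bigr => j _ do rewrite sumr_const card_ord -mulr_natl.
  rewrite -mulr_sumr; exact: (@mulf_neq0 k _ _ nt_neq0 c_neq0).
have s_inv g : g \in H -> M_fun S 0 g s = s.
  move=> Hg.
  have M_sum : M_fun S 0 g s = \sum_(h in H) M_fun S 0 g (M_fun S 0 h c).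
    pose M := GRing.isLinear.Build _ _ _ _ _ (M_linear (p_pr := p_pr) S 0 Hg).
    exact: (raddf_sum (HB.pack (M_fun S 0 g : kF -> kF) M : {linear kF -> kF})).
  rewrite M_sum /s [RHS](reindex_inj (mulIg g)) /=.
  apply: eq_big => [h|h Hh]; first by rewrite groupMr.
  by rewrite M_mul.
have [s' s's] : exists s' : kF, s' * s = 1.
  by exists ((s : k)^-1 : k); exact: (@mulVf k).
have s'_inv g : g \in H -> M_fun S 0 g s' = s'.
  move=> Hg; have := M_fun0_1 Hg; rewrite -{1}s's M_funM // s_inv // => E.
  by rewrite -[LHS]mulr1 -s's mulrCA E mulr1.
exists (s' * c); under eq_bigr => h Hh do rewrite M_funM // s'_inv //.
by rewrite -mulr_sumr.
Qed.

End GaloisAction.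

(** * Linear lifts and averaging over H *)

Lemma Fp_scale_nat (p : nat) (p_pr : prime p) (V : lmodType 'F_p) (a : 'F_p) (x : V) :
  a *: x = x *+ a.
Proof. by rewrite -scaler_nat natr_Zp. Qed.

Lemma Fp_mulrn_p (p : nat) (p_pr : prime p) (V : lmodType 'F_p) (x : V) : x *+ p = 0.
Proof. by rewrite -scaler_nat pchar_Fp_0 // scale0r. Qed.

(** Scalars of F_p are multiples, so an additive relation respects them, and lifts of a basis extend
    linearly. *)
Lemma linear_lift (p : nat) (p_pr : prime p) (U : vectType 'F_p) (V : lmodType 'F_p)
    (R : U -> V -> Prop) :
    R 0 0 -> (forall x y c d, R x c -> R y d -> R (x + y) (c + d)) ->
    (forall x, exists c, R x c) ->
  exists s : {linear U -> V}, forall x, R x (s x).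
Proof.
move=> R0 RD /choice[g gR]; pose b := vbasis {: U}.
pose s (x : U) := \sum_i coord b i x *: g b`_i.
have s_lin : linear s.
  move=> a x y; rewrite /s scaler_sumr -big_split; apply: eq_bigr => i _ /=.
  by rewrite linearP scalerDl scalerA.
exists (HB.pack s (GRing.isLinear.Build _ _ _ _ _ s_lin) : {linear U -> V}) => x /=.
have RMn y c n : R y c -> R (y *+ n) (c *+ n).
  by move=> Ryc; elim: n => // n IHn; rewrite !mulrS; apply: RD.
rewrite {1}(coord_vbasis (memvf x)) /s.
elim/big_ind2: _ => [//|x1 c1 x2 c2|i _]; first exact: RD.
by rewrite !Fp_scale_nat //; apply: RMn.
Qed.

Lemma gal_average_linear (p : nat) (gT : finGroupType) (H : {group gT})
    (V W : lmodType 'F_p) (A : FpH_action H V) (B : FpH_action H W)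
    (theta : {linear V -> V}) (s : {linear V -> W}) :
  linear (fun x => \sum_(h in H) B h (s (theta (A h^-1%g x)))).
Proof.
move=> a x y; rewrite scaler_sumr -big_split; apply: eq_bigr => h Hh /=.
by rewrite act_linear ?groupV // !linearP act_linear.
Qed.

(** Reindexing by h -> h g absorbs g; with left-to-right composition, [B (h * g)] applies [B g]
    last. *)
Lemma gal_average_equivariant (p : nat) (gT : finGroupType) (H : {group gT})
    (V W : lmodType 'F_p) (A : FpH_action H V) (B : FpH_action H W)
    (theta : {linear V -> V}) (s : {linear V -> W}) g x : g \in H ->
  \sum_(h in H) B h (s (theta (A h^-1%g (A g x)))) =
  B g (\sum_(h in H) B h (s (theta (A h^-1%g x)))).
Proof.
move=> Hg.
have B_sum (f : gT -> W) : B g (\sum_(h in H) f h) = \sum_(h in H) B g (f h).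
  exact: (raddf_sum (HB.pack (B g) (GRing.isLinear.Build _ _ _ _ _ (act_linear B Hg))
    : {linear W -> W})).
rewrite B_sum (reindex_inj (mulIg g)) /=.
apply: eq_big => [h|h Hh]; first by rewrite groupMr.
have Hh' : h \in H by rewrite groupMr in Hh.
have <- : A (h * g)^-1%g (A g x) = A h^-1%g x.
  by rewrite -act_mul ?groupV ?groupM // invMg mulKVg.
by rewrite act_mul.
Qed.

(** * The unit filtration on power classes and its graded pieces *)

Section ClassFiltration.
Variables (p : nat) (p_pr : prime p) (K : fieldType) (F : splittingFieldType K).
Variables (vK : dvaluation p K) (vF : dvaluation p F) (S : splitting vK vF).
Local Notation H := 'Gal({:F} / 1)%G.
Local Notation pi := (unif S).
Local Notation e := (ramification_index vK vF).
Local Notation kF := (residue_space vF p_pr).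
Local Notation V := (power_classes F p_pr).
Local Notation A := (power_classes_action F p_pr).

Lemma power_class0 : power_class p_pr (0 : mul_group F) = 0.
Proof. exact: (raddf0 (\pi_(Quotient.quot (mg_powers p (F:=F))))%qT). Qed.

Lemma power_classMn (x : mul_group F) n : power_class p_pr (x *+ n) = power_class p_pr x *+ n.
Proof.
by elim: n => [|n IHn]; rewrite ?power_class0 // !mulrS power_classD IHn.
Qed.

Lemma power_class_eq0 (x : mul_group F) :
  power_class p_pr x = 0 <-> exists y : mul_group F, val x = val y ^+ p.
Proof.
rewrite -power_class0; split=> [/power_classP[y]|[y yE]].
  by rewrite mul1r; exists y.
by apply/power_classP; exists y; rewrite mul1r.
Qed.

Lemma power_classN (x : mul_group F) : power_class p_pr (- x) = - power_class p_pr x.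
Proof. by apply: (addrI (power_class p_pr x)); rewrite -power_classD !subrr power_class0. Qed.

Lemma power_classes_actionE h (x : mul_group F) :
  A h (power_class p_pr x) = power_class p_pr (mg_gal h x).
Proof. exact: power_classes_funE. Qed.

Definition fil_class (n : nat) (c : V) : Prop :=
  exists2 x : mul_group F, c = power_class p_pr x & vge vF n (val x - 1).

(** Kept as a relation: the representatives of a class differ by p-th powers, so the leading
    coefficient [alpha] need not be determined by [c]. *)
Definition symbol (z : F) (alpha : kF) (c : V) : Prop :=
  exists x : mul_group F, exists2 a, a \in vring vF &
    [/\ c = power_class p_pr x, alpha = red vF a & val x = 1 + a * z].

Lemma fil_class_le m n c : (m <= n)%N -> fil_class n c -> fil_class m c.
Proof. by move=> mn [x -> vx]; exists x => //; apply: vge_le vx. Qed.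

Lemma fil_class0 n : fil_class n 0.
Proof. by exists 0; rewrite ?power_class0 //= subrr vge0. Qed.

Lemma fil_classD n c d : (0 < n)%N -> fil_class n c -> fil_class n d -> fil_class n (c + d).
Proof.
move=> n_gt0 [x -> vx] [y -> vy]; exists (x + y); rewrite ?power_classD //=.
have -> : val x * val y - 1 = val x * (val y - 1) + (val x - 1) by ring.
apply: vgeD => //; rewrite vgeMl //.
by rewrite -[val x](subrK 1) rpredD ?rpred1 // (vge_vring _ vx).
Qed.

Lemma fil_class_sum n (I : Type) (r : seq I) (P : pred I) (f : I -> V) : (0 < n)%N ->
  (forall i, P i -> fil_class n (f i)) -> fil_class n (\sum_(i <- r | P i) f i).
Proof.
by move=> n_gt0 fP; elim/big_ind: _ => // [|x y]; [apply: fil_class0 | apply: fil_classD].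
Qed.

Section Symbol.
Variables (z : F) (n : nat).
Hypotheses (z0 : z != 0) (n_gt0 : (0 < n)%N) (vz : vF z = n).

Lemma symbol_vge1 : vge vF 1 z. Proof. by rewrite vge_neq0 // vz. Qed.

Lemma symbol_fil alpha c : symbol z alpha c -> fil_class n c.
Proof.
case=> x [a va [-> _ xE]]; exists x => //.
by rewrite xE addrAC subrr add0r vgeMl // vge_neq0 // vz.
Qed.

Lemma symbol_exists alpha : exists c, symbol z alpha c.
Proof.
have [a va ->] := red_surj alpha.
have [x0 _] : 1 + a * z != 0 /\ vF (1 + a * z) = 0.
  by apply: vring1D_unit; rewrite vgeMl // symbol_vge1.
by exists (power_class p_pr (MulGroup x0)), (MulGroup x0), a.
Qed.

Lemma fil_class_symbol c : fil_class n c -> exists alpha, symbol z alpha c.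
Proof.
case=> x -> vx; exists (red vF ((val x - 1) / z)), x, ((val x - 1) / z).
  by rewrite -vge_quot // vz.
by split=> //; rewrite divfK // addrC subrK.
Qed.

Lemma symbol0P c : symbol z 0 c <-> fil_class n.+1 c.
Proof.
split=> [[x [a va [-> /esym/eqP aE xE]]]|[x -> vx]].
  move: aE; rewrite vge_red0 // => va1; exists x => //.
  rewrite xE addrAC subrr add0r -add1n PoszD -vz; apply: vgeM => //.
  by rewrite vge_neq0.
have va : vge vF 1 ((val x - 1) / z) by rewrite -vge_div // vz -PoszD addn1.
exists x, ((val x - 1) / z); first exact: vge_vring va.
split=> //; last by rewrite divfK // addrC subrK.
by apply/esym/eqP; rewrite vge_red0 //; apply: vge_vring va.
Qed.

Lemma symbolD alpha beta c d : symbol z alpha c -> symbol z beta d ->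
  symbol z (alpha + beta) (c + d).
Proof.
move=> [x [a va [-> -> xE]]] [y [b vb [-> -> yE]]].
have vz0 : z \in vring vF by apply: vge_vring symbol_vge1.
have vab : a + b \in vring vF by rewrite rpredD.
exists (x + y), (a + b + a * b * z); first by rewrite rpredD ?rpredM.
split; first by rewrite power_classD.
  (* The cross term of (1 + a z)(1 + b z) changes the coefficient only modulo the maximal ideal. *)
  have red_abz : red vF (a * b * z) = 0.
    apply/eqP; rewrite vge_red0 ?rpredM //.
    by apply: vgeMl symbol_vge1; rewrite rpredM.
  by rewrite redD ?rpredM // red_abz addr0 redD.
by rewrite /= xE yE; ring.
Qed.

Lemma symbol0 : symbol z 0 0.
Proof. by apply/symbol0P; apply: fil_class0. Qed.

Lemma symbolMn alpha c m : symbol z alpha c -> symbol z (alpha *+ m) (c *+ m).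
Proof.
move=> ac; elim: m => [|m IHm]; first exact: symbol0.
by rewrite !mulrS; apply: symbolD.
Qed.

Lemma symbolB alpha beta c d : symbol z alpha c -> symbol z beta d ->
  symbol z (alpha - beta) (c - d).
Proof.
(* Both sides are killed by p, so the opposite is the multiple by p - 1. *)
move=> ac bd; apply: symbolD => //; have := symbolMn p.-1 bd.
have opp_mul (W : lmodType 'F_p) (w : W) : w *+ p.-1 = - w.
  by apply: (addIr w); rewrite addNr -mulrSr prednK ?prime_gt0 // Fp_mulrn_p.
by rewrite !opp_mul.
Qed.

(** The conjugate of 1 + a z is 1 + (h z / z) h(a) z. The twist h z / z yields M_n for z = pi^n and
    the cyclotomic character for z = lam^p. *)
Lemma symbol_gal alpha c h : h \in H -> h z / z \in vring vF -> symbol z alpha c ->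
  symbol z (red vF (h z / z) * M_fun S 0 h alpha) (A h c).
Proof.
move=> Hh vhz [x [a va [-> -> xE]]].
have [vha ->] := M_funE p_pr S 0 Hh va.
exists (mg_gal h x), (h z / z * h a); first by rewrite rpredM.
split; first exact: power_classes_actionE.
  by rewrite expr0 mul1r [RHS]redM.
by rewrite /= xE rmorphD rmorph1 rmorphM /= [h z / z * _ * z]mulrAC divfK // [h a * _]mulrC.
Qed.

End Symbol.

Lemma unifX_neq0 n : pi ^+ n != 0. Proof. by rewrite expf_neq0 ?unif_neq0. Qed.

Lemma unifX_val n : vF (pi ^+ n) = n.
Proof.
have /andP[pi0 /eqP vpi] := unif_uniformizer S.
by rewrite dvalX // vpi natz.
Qed.

Lemma symbol_unifX_gal n alpha c h : h \in H -> symbol (pi ^+ n) alpha c ->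
  symbol (pi ^+ n) (M_action p_pr S n h alpha) (A h c).
Proof.
move=> Hh nac.
have E : h (pi ^+ n) / pi ^+ n = (h pi / pi) ^+ n by rewrite rmorphXn expr_div_n.
have vr : h (pi ^+ n) / pi ^+ n \in vring vF by rewrite E rpredX ?root_ratio.
have := symbol_gal (unifX_neq0 n) Hh vr nac; congr (symbol _ _ _).
have [a va ->] := red_surj alpha.
rewrite /= (M_funE p_pr S 0 Hh va).2 (M_funE p_pr S n Hh va).2 E expr0 mul1r.
by rewrite redM ?rpredX ?root_ratio // (gal_vring p_pr S).
Qed.

Definition unif_class : V := power_class p_pr (MulGroup (unif_neq0 S)).

(** A power of [pi] removes the valuation; a p-th power then removes the residue, by perfectness. *)
Lemma fil_class_exists c : exists m, fil_class 1 (c - unif_class *+ m).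
Proof.
have [x ->] := power_class_surj c; have x0 := mg_valP x.
have pi0 := unif_neq0 S; have /andP[_ /eqP vpi] := unif_uniformizer S.
have p_gt0 := prime_gt0 p_pr.
(* Adding p d makes the exponent nonnegative without changing it modulo p. *)
set d := absz (vF (val x)); pose m := absz (vF (val x) + (p * d)%N)%R.
have mE : m%:Z = vF (val x) + (p * d)%N by rewrite /m /d; nia.
pose y := val x * pi ^+ (p * d) / pi ^+ m.
have y0 : y != 0 by rewrite !mulf_neq0 ?invr_eq0 ?expf_neq0.
have vy : vF y = 0.
  rewrite /y dvalM ?mulf_neq0 ?invr_eq0 ?expf_neq0 // dvalV ?expf_neq0 // dvalM ?expf_neq0 //.
  by rewrite !unifX_val -mE subrr.
have [a va ya] := res_pth_root p_pr (residueF_finite p_pr S) (unit_vring vy).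
have red_y : red vF y = red vF a ^+ p.
  by rewrite -redX //; apply/eqP; rewrite red_eq ?rpredX // (unit_vring vy).
have [a0 va0] : a != 0 /\ vF a = 0.
  apply: (red_unit va); apply: contraNneq (unit_red y0 vy) => red_a.
  by rewrite red_y red_a expr0n gtn_eqF.
exists m; exists (x - MulGroup (unif_neq0 S) *+ m +
  MulGroup (mulf_neq0 (expf_neq0 d pi0) (invr_neq0 a0)) *+ p).
  rewrite power_classD !power_classMn Fp_mulrn_p // addr0 power_classD power_classN.
  by rewrite power_classMn /unif_class.
rewrite /= !mg_valX /=.
have -> : val x / pi ^+ m * (pi ^+ d / a) ^+ p - 1 = (y - a ^+ p) / a ^+ p.
  rewrite mulrBl divff ?expf_neq0 // /y expr_div_n -exprM [(d * p)%N]mulnC.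
  by rewrite !mulrA; congr (_ - _); rewrite [val x / _ * _]mulrAC.
by rewrite -vge_div ?expf_neq0 // dvalX // va0 mul0rn add0r.
Qed.

(** A p-th power has valuation divisible by p, and elements of U_1 have valuation 0. *)
Lemma unif_class_dvd m c : fil_class 1 c -> unif_class *+ m + c = 0 -> (p %| m)%N.
Proof.
move=> [x -> vx]; rewrite -power_classMn -power_classD => /power_class_eq0[y].
rewrite /= mg_valX /= => /(congr1 vF).
have [x0 vx0] : val x != 0 /\ vF (val x) = 0.
  by rewrite -[val x](subrK 1) addrC; apply: vring1D_unit.
rewrite dvalM ?unifX_neq0 // unifX_val vx0 addr0 dvalX ?mg_valP //.
rewrite -[_ *+ p]mulr_natl natz => /(congr1 absz).
by rewrite abszM => /= ->; rewrite dvdn_mulr.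
Qed.

Hypothesis tame : coprime p e.

(* Averaging the [F_p]-linear lift over [H] against multiplication by an element
   of trace one makes it equivariant; this is the projectivity of [M_i]. *)
Lemma equivariant_lift n : (0 < n)%N ->
  exists s : {linear kF -> V}, (forall x, symbol (pi ^+ n) x (s x)) /\
    (forall h, h \in H -> forall x, s (M_action p_pr S n h x) = A h (s x)).
Proof.
move=> n_gt0; have z0 := unifX_neq0 n; have vz := unifX_val n.
(* Finiteness of the residue field provides the basis needed by [linear_lift]; [s1] below is the
   same map on [residue_space]. *)
pose pk : p \in [pchar finresidue (residueF_finite p_pr S)] := residue_pchar vF p_pr.
have [s0 s0P] := @linear_lift p p_pr (pPrimeCharType pk) V (symbol (pi ^+ n))
  (symbol0 z0 vz) (symbolD z0 n_gt0 vz) (symbol_exists z0 n_gt0 vz).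
have [c cP] := trace_one p_pr S tame.
have c_lin : linear (fun x : kF => c * x).
  by move=> a x y; rewrite mulrDr Fp_scale_nat // [in RHS]Fp_scale_nat // mulrnAr.
pose theta : {linear kF -> kF} :=
  HB.pack (fun x : kF => c * x) (GRing.isLinear.Build _ _ _ _ _ c_lin).
pose s1 : {linear kF -> V} :=
  HB.pack (s0 : kF -> V) (GRing.isLinear.Build _ _ _ _ _ (linearP s0 : linear (s0 : kF -> V))).
pose M := M_action p_pr S n.
pose s (x : kF) := \sum_(h in H) A h (s1 (theta (M h^-1%g x))).
exists (HB.pack s (GRing.isLinear.Build _ _ _ _ _ (gal_average_linear M A theta s1))
  : {linear kF -> V}); split=> [x|h Hh x] /=; last exact: gal_average_equivariant.
(* Since c has trace one, averaging multiplication by c over H gives the identity, so the averaged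
   lift still has symbol x. *)
have {1}-> : x = \sum_(h in H) M h (theta (M h^-1%g x)).
  rewrite -[LHS]mul1r -cP mulr_suml; apply: eq_bigr => h Hh.
  by rewrite /= M_funM // -M_mul ?groupV // mulVg M_one.
rewrite /s; elim/big_ind2: _ => [|x1 c1 x2 c2|h Hh].
- exact: symbol0 z0 vz.
- exact: symbolD z0 n_gt0 vz _ _ _ _.
- by apply: symbol_unifX_gal => //; apply: s0P.
Qed.

End ClassFiltration.

(** * Which symbols are trivial, and the action on the top level *)

Section KummerClasses.
Variables (p : nat) (p_pr : prime p) (K : fieldType) (F : splittingFieldType K).
Variables (vK : dvaluation p K) (vF : dvaluation p F) (S : splitting vK vF).
Variables (zp : F) (zpP : p.-primitive_root zp).
Hypotheses (pF0 : p%:R != 0 :> F) (F_complete : vcomplete vF).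
Variable r : nat.
Hypotheses (r_gt0 : (0 < r)%N) (vlam : vF (zp - 1) = r) (vp : vF p%:R = (p.-1 * r)%N).
Local Notation gT := (gal_of {:F}).
Local Notation H := 'Gal({:F} / 1)%G.
Local Notation pi := (unif S).
Local Notation kF := (residue_space vF p_pr).
Local Notation V := (power_classes F p_pr).
Local Notation A := (power_classes_action F p_pr).
Local Notation lam := (zp - 1).
Local Notation lamp := (lam ^+ p).

(** A p-th power at a level n prime to p lies one level deeper, by [pth_power_gap], so its
    coefficient vanishes. *)
Lemma gap_symbol n alpha : (0 < n < p * r)%N -> coprime n p ->
  symbol (pi ^+ n) (alpha : kF) (0 : V) -> alpha = 0.
Proof.
move=> n_lt np [x [a va [/esym/power_class_eq0[y xy] -> xE]]].
have z0 := unifX_neq0 S n; have vz := unifX_val S n.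
apply/eqP; rewrite vge_red0 //.
have vaz : vge vF n (val x - 1).
  by rewrite xE addrAC subrr add0r vgeMl // vge_neq0 // vz.
have pn : ~~ (p %| n)%N by rewrite -prime_coprime // coprime_sym.
have := pth_power_gap p_pr pF0 r_gt0 vp (mg_valP y) n_lt pn; rewrite -xy => /(_ vaz).
by rewrite xE addrAC subrr add0r -addn1 PoszD -vz mulrC vge_mul2l.
Qed.

Lemma fil_class_pth_power j c : (0 < j < r)%N ->
  fil_class vF (p * j) (c : V) -> fil_class vF (p * j).+1 c.
Proof.
move=> j_lt [x -> vx].
have [y [y0 vy xy]] := fil_pth_power p_pr pF0 r_gt0 vp (residueF_finite p_pr S) j_lt vx.
exists (x - MulGroup y0 *+ p).
  by rewrite power_classD power_classN power_classMn Fp_mulrn_p // subr0.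
rewrite /= mg_valX /=; have -> : val x / y ^+ p - 1 = (val x - y ^+ p) / y ^+ p.
  by rewrite mulrBl divff ?expf_neq0.
by rewrite -vge_div ?expf_neq0 // dvalX // vy mul0rn add0r.
Qed.

Lemma lamp_neq0 : lamp != 0. Proof. by rewrite expf_neq0 ?(lam_neq0 p_pr zpP). Qed.

Lemma lamp_val : vF lamp = (p * r)%N.
Proof. by rewrite dvalX ?(lam_neq0 p_pr zpP) // vlam posz_mulrn. Qed.

Lemma lamp_level_gt0 : (0 < p * r)%N. Proof. by rewrite muln_gt0 prime_gt0. Qed.

(** One direction is [top_pth_power]. For the other, dividing by (1 + lam b)^p moves the
    representative beyond level p r, where Newton iteration finds a root. *)
Lemma top_symbolP (alpha : kF) c : symbol lamp alpha (c : V) ->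
  c = 0 <-> exists d : kF, alpha = d ^+ p - d.
Proof.
move=> [x [a va [-> -> xE]]]; split=> [/power_class_eq0[y xy]|[d ad]].
  have [|d vd ad] := top_pth_power p_pr zpP pF0 r_gt0 vlam vp va (mg_valP y).
    by rewrite -[mg_val y ^+ p]xy xE mulrC subrr vge0.
  exists (red vF d); rewrite -redX //.
  have -> : red vF (d ^+ p) - red vF d = red vF (d ^+ p - d).
    by rewrite [RHS]redD ?redN ?rpredN ?rpredX.
  by apply/eqP; rewrite red_eq ?rpredB ?rpredX.
apply/power_class_eq0; have [b vb dE] := red_surj d.
have v_ab : vge vF 1 (a - (b ^+ p - b)).
  rewrite -vmaxE -red_eq ?rpredB ?rpredX //; apply/eqP; rewrite ad dE.
  by rewrite [RHS]redD ?redN ?rpredN ?rpredX // redX.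
have [y0 vy] : 1 + lam * b != 0 /\ vF (1 + lam * b) = 0.
  apply: vring1D_unit; rewrite vgeMr // vge_neq0 ?(lam_neq0 p_pr zpP) // vlam.
  by move: r_gt0; lia.
have v_diff : vge vF (p * r).+1 (val x - (1 + lam * b) ^+ p).
  rewrite vgeBC; apply: vge_trans (pow1_lam_mod p_pr zpP pF0 r_gt0 vlam vp vb) _.
  rewrite vgeBC xE opprD addrACA subrr add0r [a * _]mulrC -mulrBr.
  by rewrite -addn1 PoszD -lamp_val vge_mul2l ?lamp_neq0.
have [|y yE] := pth_root_cvg p_pr pF0 r_gt0 vp (x := val x / (1 + lam * b) ^+ p) F_complete.
  have -> : val x / (1 + lam * b) ^+ p - 1 =
      (val x - (1 + lam * b) ^+ p) / (1 + lam * b) ^+ p.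
    by rewrite [RHS]mulrBl divff ?expf_neq0.
  by rewrite -vge_div ?expf_neq0 // dvalX // vy mul0rn add0r.
have xE' : val x = ((1 + lam * b) * y) ^+ p.
  by rewrite exprMn -yE mulrC divfK // expf_neq0.
have yb0 : (1 + lam * b) * y != 0.
  by apply: contraTneq (mg_valP x) => yb; rewrite xE' yb expr0n gtn_eqF ?prime_gt0 ?eqxx.
by exists (MulGroup yb0).
Qed.

(** With w the cyclotomic value of h, (zp^w - 1) / (zp - 1) is a sum of w powers of zp, each
    reducing to 1. *)
Lemma red_lam_ratio (h : gT) : h lam / lam \in vring vF /\
  red vF (h lam / lam) = (Defs.cyclotomic p zp h)%:R.
Proof.
have lam0 := lam_neq0 p_pr zpP; have v_lam := lam_vring p_pr vF zpP.
rewrite rmorphB rmorph1 /= (cyclotomicP p_pr zpP) subrX1 mulrC mulKf //.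
have v_zp : zp \in vring vF by rewrite -[zp](subrK 1) rpredD ?rpred1.
have red_zp : red vF zp = 1.
  by rewrite -(red1 vF); apply/eqP; rewrite red_eq ?rpred1 // vmaxE vge_neq0 // vlam; lia.
split; first by rewrite rpred_sum // => i _; rewrite rpredX.
rewrite red_sum => [|i]; last exact: rpredX.
under eq_bigr do rewrite redX // red_zp expr1n.
by rewrite sumr_const card_ord.
Qed.

(** H acts on residues through powers of Frobenius, and the difference telescopes. *)
Lemma gal_artin_schreier h (b : kF) : h \in H ->
  exists d : kF, M_fun S 0 h b - b = d ^+ p - d.
Proof.
case/(split_gal S)=> -[i j] /= ->; rewrite M_fun0_ups_tau.
have [m _ ->] := card_residue_pow p_pr (residueK_finite S).
rewrite -expnM; apply: iter_pth_power_sub; exact: residue_pchar vF p_pr.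
Qed.

(** The twist reduces to w^p = w, and h moves [b0] by some d^p - d. The two symbols therefore differ
    by w (d^p - d) = (w d)^p - w d. *)
Lemma top_class_gal (b0 : kF) (eta : V) h : symbol lamp b0 eta -> h \in H ->
  A h eta = Defs.cyclotomic p zp h *: eta.
Proof.
move=> b0_eta Hh; rewrite Fp_scale_nat //; apply/eqP; rewrite -subr_eq0; apply/eqP.
have [vr red_r] := red_lam_ratio h.
set w := Defs.cyclotomic p zp h in red_r *.
have ratioE : h lamp / lamp = (h lam / lam) ^+ p by rewrite rmorphXn expr_div_n.
have vr' : h lamp / lamp \in vring vF by rewrite ratioE rpredX.
have sym_h := symbol_gal S lamp_neq0 Hh vr' b0_eta.
have sym_w := symbolMn lamp_neq0 lamp_level_gt0 lamp_val w b0_eta.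
have sym := symbolB lamp_neq0 lamp_level_gt0 lamp_val sym_h sym_w.
apply/(top_symbolP sym).
have [d dE] := gal_artin_schreier b0 Hh.
have pk := residue_pchar vF p_pr.
have natr_pow n : (n%:R : kF) ^+ p = n%:R by rewrite -(pFrobenius_autE pk) pFrobenius_aut_nat.
exists (w%:R * d); rewrite ratioE redX // red_r.
rewrite [X in X * _]natr_pow exprMn natr_pow -mulrBr -dE mulrBr mulr_natl.
by rewrite [X in _ = _ - X]mulr_natl.
Qed.

End KummerClasses.

(** The explicit map goes from the direct sum to the power classes; the isomorphism sought is its
    inverse. *)
Lemma FpH_iso_inverse (p : nat) (gT : finGroupType) (H : {group gT})
    (V W : lmodType 'F_p) (A : FpH_action H V) (B : FpH_action H W) (f : W -> V) :
    linear f -> (forall y, f y = 0 -> y = 0) -> (forall x, exists y, f y = x) ->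
    (forall h, h \in H -> forall y, f (B h y) = A h (f y)) ->
  FpH_iso A B.
Proof.
move=> f_lin f_ker /choice[g fgK] f_gal.
have f_inj : injective f.
  move=> y y' fyy'; apply/eqP; rewrite -subr_eq0; apply/eqP/f_ker.
  by rewrite addrC -[- y']scaleN1r f_lin fyy' scaleN1r addNr.
have g_lin : linear g by move=> a c d; apply: f_inj; rewrite f_lin !fgK.
exists (HB.pack g (GRing.isLinear.Build _ _ _ _ _ g_lin) : {linear V -> W}).
split=> [|h Hh c] /=; first by exists f => // y; apply: f_inj; rewrite fgK.
by apply: f_inj; rewrite f_gal // !fgK.
Qed.

(** * Assembly of the equivariant isomorphism *)

Section Decomposition.
Variables (p : nat) (p_pr : prime p) (K : fieldType) (F : splittingFieldType K).
Variables (vK : dvaluation p K) (vF : dvaluation p F) (S : splitting vK vF).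
Variables (zp : F) (zpP : p.-primitive_root zp).
Hypotheses (tame : coprime p (ramification_index vK vF)).
Hypotheses (pF0 : p%:R != 0 :> F) (F_complete : vcomplete vF).
Variable r : nat.
Hypotheses (r_gt0 : (0 < r)%N) (vlam : vF (zp - 1) = r) (vp : vF p%:R = (p.-1 * r)%N).
Local Notation gT := (gal_of {:F}).
Local Notation H := 'Gal({:F} / 1)%G.
Local Notation pi := (unif S).
Local Notation kF := (residue_space vF p_pr).
Local Notation V := (power_classes F p_pr).
Local Notation A := (power_classes_action F p_pr).
Local Notation lamp := ((zp - 1) ^+ p).
Local Notation varpi := (unif_class p_pr S).
Local Notation I := (prime_to_p_interval vF).

Lemma unif_class_gal h : h \in H -> A h varpi = varpi.
Proof.
move=> Hh; rewrite power_classes_actionE; apply/power_classP => /=.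
(* Bezout: k p = l e + 1. As xi = h pi / pi satisfies xi^e = 1, it is the p-th power of xi^k. *)
have [k l kl _] := egcdnP (ramification_index vK vF) (prime_gt0 p_pr).
have g1 : gcdn p (ramification_index vK vF) = 1%N by apply/eqP.
have xi0 : h pi / pi != 0 by rewrite mulf_neq0 ?invr_eq0 ?fmorph_eq0 ?unif_neq0.
exists (MulGroup (expf_neq0 k xi0)); rewrite /= -exprM kl g1 exprD expr1 mulnC exprM.
by rewrite unif_ratio_powe expr1n mul1r mulrC divfK ?unif_neq0.
Qed.

(** The endpoints 0 and p r drop out: neither is prime to p. *)
Lemma intervalP (i : I) : (0 < val i < p * r)%N /\ coprime (val i) p.
Proof.
case: i => i /= ip; split=> //.
have : (i < (p * r).+1)%N by rewrite -(I_boundE p_pr pF0 r_gt0 vp) ltn_ord.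
rewrite ltnS leq_eqVlt => /orP[/eqP iE|->].
  by move: ip; rewrite iE coprimeMl /coprime gcdnn; have := prime_gt1 p_pr; case: (p) => [|[]].
rewrite andbT lt0n; apply: contraTneq ip => ->.
by rewrite /coprime gcd0n; have := prime_gt1 p_pr; case: (p) => [|[]].
Qed.

Lemma intervalE j : (0 < j < p * r)%N -> coprime j p -> exists i : I, val i = j :> nat.
Proof.
move=> /andP[_ jI] jp; have j_lt : (j < (I_bound vF).+1)%N.
  by rewrite (I_boundE p_pr pF0 r_gt0 vp) ltnS ltnW.
by exists (exist (fun i : 'I_(I_bound vF).+1 => coprime i p) (Ordinal j_lt) jp).
Qed.

Variable s : I -> {linear kF -> V}.
Hypothesis s_symbol : forall (i : I) x, symbol (pi ^+ val i) x (s i x).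
Hypothesis s_gal : forall (i : I) h, h \in H -> forall x,
  s i (M_action p_pr S (val i) h x) = A h (s i x).
Variables (b0 : kF) (eta : V).
Hypothesis b0_eta : symbol lamp b0 eta.
Hypothesis b0_span : forall b : kF, exists m, exists d : kF, b = b0 *+ m + (d ^+ p - d).
Hypothesis b0_free : forall m (d : kF), b0 *+ m = d ^+ p - d -> (p %| m)%N.

Definition decomposition (y : ('F_p)^o * {ffun I -> kF} * ('F_p)^o) : V :=
  (y.1.1 : 'F_p) *: varpi + \sum_i s i (y.1.2 i) + (y.2 : 'F_p) *: eta.

Lemma decomposition_linear : linear decomposition.
Proof.
move=> a [[n x] m] [[n' x'] m']; rewrite /decomposition /= !scalerDl -!scalerA.
have -> : \sum_i s i ((a *: x + x') i) =
    a *: \sum_i s i (x i) + \sum_i s i (x' i).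
  by rewrite scaler_sumr -big_split; apply: eq_bigr => i _; rewrite !ffunE linearP.
rewrite !scalerDr -!addrA; congr (_ + _); rewrite addrCA; congr (_ + _).
by rewrite !addrA; congr (_ + _); rewrite addrC addrA.
Qed.

Lemma power_class_action_sum (J : Type) (l : seq J) (f : J -> V) h : h \in H ->
  A h (\sum_(j <- l) f j) = \sum_(j <- l) A h (f j).
Proof.
move=> Hh; exact: (raddf_sum (HB.pack (A h)
  (GRing.isLinear.Build _ _ _ _ _ (act_linear A Hh)) : {linear V -> V})).
Qed.

Lemma decomposition_gal h y : h \in H ->
  decomposition (FpH_sum (FpH_sum (FpH_trivial p H)
    (FpH_bigsum (fun i : I => M_action p_pr S (val i))))
    (cyclotomic_action p_pr zpP) h y) = A h (decomposition y).
Proof.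
move=> Hh; case: y => [[n x] m]; rewrite /decomposition.
have AD c d : A h (c + d) = A h c + A h d.
  by have := act_linear A Hh 1 c d; rewrite !scale1r.
have AZ a c : A h (a *: c) = a *: A h c.
  have A0 : A h 0 = 0 by apply: (addrI (A h 0)); rewrite -AD !addr0.
  by have := act_linear A Hh a c 0; rewrite A0 !addr0.
rewrite !AD !AZ unif_class_gal // power_class_action_sum //.
rewrite (top_class_gal S zpP pF0 F_complete r_gt0 vlam vp b0_eta Hh).
congr (_ + _ + _) => /=.
  by apply: eq_bigr => i _; rewrite ffunE s_gal.
by rewrite scalerA mulrC.
Qed.

Lemma lamp_eta_fil m : fil_class vF (p * r) (eta *+ m).
Proof.
have sym := symbolMn (lamp_neq0 p_pr zpP) (lamp_level_gt0 p_pr r_gt0)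
  (lamp_val p_pr zpP vlam) m b0_eta.
by have := symbol_fil (lamp_neq0 p_pr zpP) (lamp_val p_pr zpP vlam) sym.
Qed.

Lemma s_fil (i : I) x : fil_class vF (val i) (s i x).
Proof. by have := symbol_fil (unifX_neq0 S _) (unifX_val S _) (s_symbol i x). Qed.

(** Coordinates vanish in order of level: [n] by valuation, each [x i] by its symbol, and [m] by
    independence of [b0] from the Artin-Schreier image. *)
Lemma decomposition_inj y : decomposition y = 0 -> y = 0.
Proof.
case: y => [[n x] m]; rewrite /decomposition /= => y0.
have Fp0 (a : 'F_p) : (p %| a)%N -> a = 0.
  by move=> pa; apply/eqP; rewrite -[a]natr_Zp -(dvdn_pcharf (pchar_Fp p_pr)).
have fil1 : fil_class vF 1 (\sum_i s i (x i) + eta *+ (m : 'F_p)).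
  apply: fil_classD => //.
    apply: fil_class_sum => // i _; have [/andP[i_gt0 _] _] := intervalP i.
    exact: fil_class_le i_gt0 (s_fil i (x i)).
  by apply: fil_class_le (lamp_eta_fil _); rewrite (lamp_level_gt0 p_pr r_gt0).
have n0 : n = 0.
  apply: Fp0; apply: (unif_class_dvd (S := S) fil1).
  by rewrite addrA -!Fp_scale_nat.
rewrite n0 scale0r add0r in y0.
have x0 j : forall i : I, (val i < j)%N -> x i = 0.
  elim: j => [//|j IHj] i; rewrite ltnS leq_eqVlt => /orP[/eqP ij|]; last exact: IHj.
  have [i_lt ip] := intervalP i; have /andP[i_gt0 iI] := i_lt.
  apply: (gap_symbol pF0 r_gt0 vp i_lt ip (S := S)).
  (* All other terms lie deeper: smaller indices vanish by induction, larger ones and [eta] start at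
     a later level. *)
  have rest : fil_class vF (val i).+1
      (\sum_(i' | i' != i) s i' (x i') + (m : 'F_p) *: eta).
    apply: fil_classD => //; last first.
      by rewrite Fp_scale_nat //; apply: fil_class_le (lamp_eta_fil _).
    apply: fil_class_sum => // i' i'i.
    have [lt_i'|ge_i'] := ltnP (val i') j.
      by rewrite IHj // linear0; apply: fil_class0.
    apply: fil_class_le (s_fil i' (x i')); rewrite ltn_neqAle ij ge_i' andbT -ij.
    by apply: contraNneq i'i => E; apply/eqP/val_inj/val_inj.
  have := symbolD (unifX_neq0 S _) i_gt0 (unifX_val S _) (s_symbol i (x i))
    ((symbol0P (unifX_neq0 S _) (unifX_val S _) _).2 rest).
  have sumE : \sum_i' s i' (x i') = s i (x i) + \sum_(i' | i' != i) s i' (x i').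
    exact: bigD1.
  by rewrite addr0 addrA -sumE y0.
have {}x0 : x = 0 by apply/ffunP => i; rewrite (x0 (val i).+1) ?ffunE.
have m0 : m = 0.
  apply: Fp0; move: y0; rewrite big1 ?add0r => [|i _]; last first.
    by rewrite x0 ffunE linear0.
  rewrite Fp_scale_nat // => y0.
  have := symbolMn (lamp_neq0 p_pr zpP) (lamp_level_gt0 p_pr r_gt0)
    (lamp_val p_pr zpP vlam) (m : 'F_p) b0_eta.
  by move/(top_symbolP zpP pF0 F_complete r_gt0 vlam vp)=> [/(_ y0)[d /b0_free]].
by rewrite n0 x0 m0.
Qed.

(** Levels are cleared upwards: at j prime to p by subtracting a value of the lift, at multiples of
    p by changing the representative, at p r by [b0_span]. *)
Lemma decomposition_surj c : exists y, decomposition y = c.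
Proof.
have imD d d' : (exists y, decomposition y = d) -> (exists y, decomposition y = d') ->
    exists y, decomposition y = d + d'.
  move=> [y yd] [y' yd']; exists (1 *: y + y').
  by rewrite decomposition_linear scale1r yd yd'.
have im_unif m : exists y, decomposition y = varpi *+ m.
  exists ((m%:R : 'F_p) : ('F_p)^o, 0, 0).
  rewrite /decomposition /= scale0r addr0 big1 ?addr0 => [|i _]; last first.
    by rewrite ffunE linear0.
  by rewrite scaler_nat.
have im_eta m : exists y, decomposition y = eta *+ m.
  exists (0, 0, (m%:R : 'F_p) : ('F_p)^o).
  rewrite /decomposition /= scale0r add0r big1 ?add0r => [|i _]; last first.
    by rewrite ffunE linear0.
  by rewrite scaler_nat.
have im_s i x : exists y, decomposition y = s i x.
  exists (0, [ffun i' => if i' == i then x else 0], 0).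
  rewrite /decomposition /= !scale0r add0r addr0 (bigD1 i) //= ffunE eqxx.
  by rewrite big1 ?addr0 // => i' /negbTE i'i; rewrite ffunE i'i linear0.
have im_top d : fil_class vF (p * r) d -> exists y, decomposition y = d.
  move=> fil_d.
  have [al al_d] := fil_class_symbol (lamp_neq0 p_pr zpP) (lamp_val p_pr zpP vlam) fil_d.
  have [m [w alE]] := b0_span al.
  have sym_m := symbolMn (lamp_neq0 p_pr zpP) (lamp_level_gt0 p_pr r_gt0)
    (lamp_val p_pr zpP vlam) m b0_eta.
  have := symbolB (lamp_neq0 p_pr zpP) (lamp_level_gt0 p_pr r_gt0)
    (lamp_val p_pr zpP vlam) al_d sym_m.
  move/(top_symbolP zpP pF0 F_complete r_gt0 vlam vp)=> [_ dE].
  have /eqP : d - eta *+ m = 0 by apply: dE; exists w; rewrite alE addrAC subrr add0r.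
  by rewrite subr_eq0 => /eqP->; apply: im_eta.
(* Induction on the number k of levels left below p r. *)
have im_fil k : forall j d, (0 < j)%N -> (j + k = p * r)%N -> fil_class vF j d ->
    exists y, decomposition y = d.
  elim: k => [|k IHk] j d j_gt0 jk fil_d.
    by apply: im_top; rewrite -jk addn0.
  have jI : (0 < j < p * r)%N by rewrite j_gt0 -jk addnS ltnS leq_addr.
  have jSk : (j.+1 + k = p * r)%N by rewrite addSnnS.
  have [jp|] := boolP (coprime j p).
    have [i ij] := intervalE jI jp; rewrite -ij in fil_d jSk *.
    have [al al_d] := fil_class_symbol (unifX_neq0 S _) (unifX_val S _) fil_d.
    have /andP[i_gt0 _] := (intervalP i).1.
    have := symbolB (unifX_neq0 S _) i_gt0 (unifX_val S _) al_d (s_symbol i al).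
    rewrite subrr => /(symbol0P (unifX_neq0 S _) (unifX_val S _)) fil_S.
    rewrite -[d](subrK (s i al)); apply: imD; last exact: im_s.
    exact: IHk fil_S.
  rewrite coprime_sym prime_coprime // negbK => /dvdnP[j' jE].
  apply: (IHk j.+1) => //; rewrite jE mulnC in fil_d jI *.
  apply: (fil_class_pth_power S pF0 r_gt0 vp) fil_d.
  case/andP: jI; rewrite muln_gt0 => /andP[_ ->].
  by rewrite ltn_pmul2l ?prime_gt0.
have [m fil1] := fil_class_exists S c.
have -> : c = varpi *+ m + (c - varpi *+ m) by rewrite addrC subrK.
apply: imD; first exact: im_unif.
apply: (im_fil (p * r).-1 1%N) => //.
by rewrite add1n prednK // muln_gt0 prime_gt0.
Qed.

End Decomposition.

Theorem proposition4p4 (p : nat) (p_pr : prime p)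
    (* Q_p *)
    (Qp : fieldType) (vp : dvaluation p Qp) (Qp_completion : is_Qp vp)
    (* the p-adic field K *)
    (K : fieldExtType Qp) (vK : dvaluation p K) (vK_vp : lies_over vp vK)
    (* the finite normal extension F / K *)
    (F : splittingFieldType K) (vF : dvaluation p F) (vF_vK : lies_over vK vF)
    (tame : coprime p (ramification_index vK vF))
    (split_data : splitting vK vF)
    (zp : F) (zpP : p.-primitive_root zp) :
  FpH_iso
    (power_classes_action F p_pr)
    (FpH_sum
      (FpH_sum
        (FpH_trivial p 'Gal({:F} / 1)%G)
        (FpH_bigsum (fun i : prime_to_p_interval vF =>
           M_action p_pr split_data (nat_of_ord (val i)))))
      (cyclotomic_action p_pr zpP)).
Proof.
have pQp0 : p%:R != 0 :> Qp.
  by have /pcharf0P-> := Qp_char0 Qp_completion; rewrite -lt0n prime_gt0.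
(* Completeness passes directly from Q_p to F along the composite embedding. *)
pose iota : {rmorphism Qp -> F} := in_alg F \o in_alg K.
have pF0 : p%:R != 0 :> F by rewrite -(rmorph_nat iota) fmorph_eq0.
have fin := residueF_finite p_pr split_data.
have F_complete : vcomplete vF.
  apply: (vcomplete_ext (Qp_complete Qp_completion) pQp0 (iota := iota)) fin => x vx.
  by rewrite /iota /= (vF_vK x%:A) vK_vp.
have [r r_gt0 [vlam vpr]] := dval_lam p_pr vF zpP pF0.
have pk : p \in [pchar finresidue fin] by exact: residue_pchar vF p_pr.
have [b0 [b0_span b0_free]] := artin_schreier_coker pk.
have [eta b0_eta] := symbol_exists (lamp_neq0 p_pr zpP) (lamp_level_gt0 p_pr r_gt0)
  (lamp_val p_pr zpP vlam) (b0 : residue_space vF p_pr).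
have /choice[s sP] (i : prime_to_p_interval vF) :
    exists s : {linear residue_space vF p_pr -> power_classes F p_pr},
      (forall x, symbol (unif split_data ^+ val i) x (s x)) /\
      (forall h, h \in 'Gal({:F} / 1)%G -> forall x,
        s (M_action p_pr split_data (val i) h x) = power_classes_action F p_pr h (s x)).
  have [/andP[i_gt0 _] _] := intervalP p_pr pF0 r_gt0 vpr i.
  exact: (equivariant_lift p_pr split_data tame i_gt0).
apply: (FpH_iso_inverse (f := decomposition split_data s eta)).
- exact: decomposition_linear.
- move=> y; apply: (decomposition_inj zpP pF0 F_complete r_gt0 vlam vpr _ b0_eta b0_free) => i x.
  by have [] := sP i.
- apply: (decomposition_surj zpP pF0 F_complete r_gt0 vlam vpr _ b0_eta b0_span) => i x.
  by have [] := sP i.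
- move=> h Hh y.
  exact: (decomposition_gal zpP tame pF0 F_complete r_gt0 vlam vpr (fun i => (sP i).2) b0_eta y Hh).
Qed.
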